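(* Let $d\ge 1$, let $\sigma\in(0,1)$ be such that $0<2\sigma<d$, and let $u$ be an $\mathcal{H}^\sigma$-harmonic function of a positive fractional Schrödinger operator $\mathcal{H}^\sigma=\Delta^\sigma+V$ on $\mathbb{Z}^d$ with $V\le1$. If $$u\in O\big(|x|^{2\sigma-d}\big)\qquad\text{and}\qquad\liminf_{x\to\infty}|u(x)|\,|x|^{2\sigma+d}=0,$$ then $u=0$.
   Context: On $\mathbb{Z}^d$, $|x|$ is the Euclidean norm, and $L$ is the bounded positive selfadjoint operator on $\ell^2(\mathbb{Z}^d)$ given by $Lf(x)=\sum_{|y-x|=1}(f(x)-f(y))$, with heat semigroup $\mathrm{e}^{-tL}$. For $\sigma\in(0,1)$ let $$b_\sigma(x,y)=\frac1{|\Gamma(-\sigma)|}\int_0^\infty(\mathrm{e}^{-tL}1_y)(x)\,\frac{\mathrm{d}t}{t^{1+\sigma}}\quad(x\neq y),\qquad b_\sigma(x,x)=0,$$ where $1_y$ is the characteristic function of $\{y\}$; $b_\sigma$ is a symmetric weight with $\sum_yb_\sigma(x,y)<\infty$. Let $\mathcal{F}_{b_\sigma}=\{f:\mathbb{Z}^d\to\mathbb{R}\mid\sum_yb_\sigma(x,y)|f(y)|<\infty\text{ for all }x\}$. The fractional Laplacian is $\Delta^\sigma f(x)=\sum_{y\in\mathbb{Z}^d}b_\sigma(x,y)(f(x)-f(y))$ for $f\in\mathcal{F}_{b_\sigma}$; it extends the spectrally defined operator $L^\sigma$ on $\ell^2(\mathbb{Z}^d)$. For a potential $V:\mathbb{Z}^d\to\mathbb{R}$,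 $\mathcal{H}^\sigma f=\Delta^\sigma f+Vf$, $f\in\mathcal{F}_{b_\sigma}$. A function $u$ is $\mathcal{H}^\sigma$-harmonic if $u\in\mathcal{F}_{b_\sigma}$ and $\mathcal{H}^\sigma u=0$ on $\mathbb{Z}^d$. $\mathcal{H}^\sigma$ is positive if there exists a nontrivial $w\in\mathcal{F}_{b_\sigma}$, $w\ge0$, with $\mathcal{H}^\sigma w\ge0$; equivalently, $\frac12\sum_{x,y}b_\sigma(x,y)(\varphi(x)-\varphi(y))^2+\sum_xV(x)\varphi(x)^2\ge0$ for all finitely supported $\varphi$. The limit $x\to\infty$ means that $x$ leaves every finite set, and $f\in O(g)$ means $\limsup_{x\to\infty}|f(x)|/|g(x)|<\infty$. *)

(* Defs.v *)
From HB Require Import structures.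
From mathcomp Require Import all_boot all_order all_algebra.
From mathcomp Require Import all_classical all_reals all_analysis.

Set Implicit Arguments.
Unset Strict Implicit.
Unset Printing Implicit Defensive.
Import Order.TTheory GRing.Theory Num.Theory.
Import numFieldNormedType.Exports.

Local Open Scope classical_set_scope.
Local Open Scope ring_scope.

Notation lattice d := 'rV[int]_d.

Section FractionalLaplacian.
Variables (R : realType) (d : nat).
Implicit Types (x y : lattice d) (f g u w V : lattice d -> R) (s t : R).

Definition enorm x : R := Num.sqrt (\sum_(i < d) ((x 0 i)%:~R) ^+ 2).

(* "x tends to infinity" means that x leaves every finite set: the limits are
   taken along the complements of finite sets. *)
Definition at_infinity : set (set (lattice d)) := [set A | cofinite_set A].

Definition limsup_infinity (h : lattice d -> \bar R) : \bar R :=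
  ereal_inf [set ereal_sup (h @` A) | A in at_infinity].

Definition liminf_infinity (h : lattice d -> \bar R) : \bar R :=
  ereal_sup [set ereal_inf (h @` A) | A in at_infinity].

(* f \in O(g); the values of g on a finite set, in particular a zero of g at
   the origin, do not matter. *)
Definition is_bigO f g : Prop :=
  (limsup_infinity (fun x => (`|f x| / `|g x|)%:E) < +oo)%E.

(* The sum ranges over the 2d neighbours of x, hence over a finite set (on an
   infinite support \sum_(_ \in _) would be 0 by convention). *)
Definition laplacian f : lattice d -> R :=
  fun x => \sum_(y \in [set y | enorm (y - x) = 1]) (f x - f y).

(* e^{-tL} f evaluated at x. As L is bounded on l^2, e^{-tL} is given by the
   exponential series; it converges in operator norm, hence pointwise after
   application to f in l^2. *)
Definition heat t f : lattice d -> R :=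
  fun x => limn (series (fun n => (- t) ^+ n / n`!%:R * iter n laplacian f x)).

Definition Euler_Gamma s : R :=
  \int[@lebesgue_measure R]_(t in `]0, +oo[) (t `^ (s - 1) * expR (- t)).

(* Gamma extended to nonpositive non-integers by
   Gamma(s) = Gamma(s + n) / (s (s + 1) ... (s + n - 1)), where n is the least
   natural number with s + n > 0. *)
Definition Gamma s : R :=
  let n := if 0 < s then 0%N else (Num.truncn (- s)).+1 in
  Euler_Gamma (s + n%:R) / \prod_(i < n) (s + i%:R).

Definition frac_weight s x y : R :=
  if x == y then 0 else
  `|Gamma (- s)|^-1 *
    \int[@lebesgue_measure R]_(t in `]0, +oo[)
      (heat t \1_[set y] x / t `^ (1 + s)).

Definition frac_domain s : set (lattice d -> R) :=
  [set f | forall x,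
     (\esum_(y in [set: lattice d]) (frac_weight s x y * `|f y|)%:E < +oo)%E].

(* Unordered sum of a real family, as the difference of the sums of its
   positive and negative parts; meaningful when the family is absolutely
   summable. *)
Definition lattice_sum (h : lattice d -> R) : R :=
  fine (esum [set: lattice d] (EFin \o h)^\+
        - esum [set: lattice d] (EFin \o h)^\-)%E.

Definition frac_laplacian s f : lattice d -> R :=
  fun x => lattice_sum (fun y => frac_weight s x y * (f x - f y)).

Definition frac_schrodinger s V f : lattice d -> R :=
  fun x => frac_laplacian s f x + V x * f x.

Definition is_harmonic s V u : Prop :=
  frac_domain s u /\ forall x, frac_schrodinger s V u x = 0.

Definition positive_schrodinger s V : Prop :=
  exists w, [/\ frac_domain s w,
                exists x, w x <> 0,
                forall x, 0 <= w x
              & forall x, 0 <= frac_schrodinger s V w x].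

End FractionalLaplacian.

(* Main.v *)
Require Import Defs.
From mathcomp Require Import all_boot all_order all_algebra.
From mathcomp Require Import all_classical all_reals all_analysis.
From mathcomp Require Import measurable_realfun.
From mathcomp Require Import ring lra zify.
Set Implicit Arguments.
Unset Strict Implicit.
Unset Printing Implicit Defensive.
Import Order.TTheory GRing.Theory Num.Theory.
Import numFieldNormedType.Exports.
Local Open Scope classical_set_scope.
Local Open Scope ring_scope.

(** Write [b] for the weight, [w] for a positive supersolution of the operator
    [H], and [D x] for [V x] plus the sum of [b x y] over [y].  Then [H u = 0]
    says that the sum of [b x y * u y] over [y] is [D x * u x], while the sum of
    [b x y * w y] is at most [D x * w x].  Testing the quadratic
    form of [H] on [u * e], with a finitely supported cutoff [e], and comparing
    the ground state transforms with respect to [w] and to [u] gives, for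
    [psi = u * e / w],

      sum b(x,y) w(x) w(y) (psi(x) - psi(y))^2
         <= sum b(x,y) u(x) u(y) (e(x) - e(y))^2.

    Let [e] be 1 on the box of radius [n] and 0 off the box of radius [2 n].
    A pair with [e x <> e y] has one point in the large box and one, say [y],
    off the small box, so that [|u y|] is at most of order [n ^ (2 sigma - d)].  The sum
    over [y] of [b x y * min(1, |x - y| / n)^2] is at most of order [n ^ (- 2 sigma)],
    and the sum of [|u|] over the large box is [o(n ^ d)] because [u] tends to 0.
    Hence the right-hand side tends to 0 as [n] grows ([ratio_difference_le]), and
    [u = c * w] for a constant [c] ([ratio_constant]).

    If [c] were not 0, then [|u|] would inherit the lower bound of [w]:
    [D] is bounded above since [V <= 1], so [w x] is at least a constant times
    [b x 0 * w 0], and [b x 0] is at least a constant times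
    [|x| ^ (- d - 2 sigma)] ([positive_solution_lower]).  This contradicts the
    vanishing lower limit.

    Both bounds on [b] come from the heat kernel.  Writing [L = 4 d (1 - Q)] with
    the lazy average [Q] makes [e^{-tL}] a Poisson mixture of the powers of [Q].
    As [Q] is positive, fixes constants and adds 1/2 to [|x|^2], the kernel has
    mass at most 1 and second moment at most [2 d t]; integrating in [t] gives
    the upper bound ([sum_translation_weight_trunc]).  For the lower bound
    ([translation_weight_lower]), [Q] preserves functions that decrease in every
    [|x_i|], so the kernel at [x] dominates its values at all points that are
    further out in every coordinate; that those points carry a fixed mass at
    times of order [|x|^2] is seen by testing against the product of the
    [1 - cos (theta x_i)], a combination of eigenfunctions of [Q]
    ([heat_kernel_lower]). *)

(** * The Laplacian as a sum over unit vectors *)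

Section Neighbours.
Variables (R : realType) (d : nat).
Implicit Types (x y z : lattice d) (f g : lattice d -> R).

Definition unit_vec (i : 'I_d) : lattice d := delta_mx 0 i.

Definition neighbours x : seq (lattice d) :=
  [seq x + unit_vec i | i <- enum 'I_d] ++ [seq x - unit_vec i | i <- enum 'I_d].

Lemma unit_vecE i j : unit_vec i 0 j = (j == i)%:R.
Proof. by rewrite mxE eqxx. Qed.

Lemma add_unit_vecE x i j : (x + unit_vec i) 0 j = x 0 j + (j == i)%:R.
Proof. by rewrite mxE unit_vecE. Qed.

Lemma sub_unit_vecE x i j : (x - unit_vec i) 0 j = x 0 j - (j == i)%:R.
Proof. by rewrite mxE [X in _ + X]mxE unit_vecE. Qed.

Lemma unit_vec_inj : injective unit_vec.
Proof.
move=> i j /matrixP/(_ 0 i); rewrite !unit_vecE eqxx.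
by case: eqP.
Qed.

Lemma neighbours_uniq x : uniq (neighbours x).
Proof.
have h1 : injective (fun i => x + unit_vec i) by move=> i j /addrI/unit_vec_inj.
have h2 : injective (fun i => x - unit_vec i).
  by move=> i j /addrI/oppr_inj/unit_vec_inj.
rewrite cat_uniq (map_inj_uniq h1) (map_inj_uniq h2) enum_uniq andbT /=.
apply/hasPn => _ /mapP[i _ ->]; apply/negP => /mapP[j _].
move/addrI/matrixP/(_ 0 i); rewrite mxE !unit_vecE eqxx.
by case: eqP.
Qed.

(** A nonzero integer has square at least 1, so that only one coordinate of a
    vector of norm 1 is nonzero. *)
Lemma enorm_eq1 z : enorm R z = 1 <-> exists i, z = unit_vec i \/ z = - unit_vec i.
Proof.
have -> : (enorm R z = 1) <-> \sum_(i < d) (z 0 i) ^+ 2 = 1 :> int.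
  rewrite /enorm.
  have -> : \sum_(i < d) (z 0 i)%:~R ^+ 2 = (\sum_(i < d) (z 0 i) ^+ 2)%:~R :> R.
    by rewrite rmorph_sum/=; apply: eq_bigr => i _; rewrite rmorphXn.
  set S := \sum_(i < d) _.
  have S0 : (0 <= S%:~R :> R) by rewrite ler0z; apply: sumr_ge0 => i _; exact: sqr_ge0.
  split=> [h|->]; last by rewrite sqrtr1.
  have := sqr_sqrtr S0; rewrite h expr1n => h1.
  by apply/eqP; rewrite -(eqr_int R) -h1.
split=> [h|[i [->|->]]].
- have [i zi] : exists i, z 0 i != 0.
    have [//|h0] := pselect (exists i, z 0 i != 0).
    move: h; rewrite big1 // => i _.
    have [->//|zi] := eqVneq (z 0 i) 0.
    by case: h0; exists i.
  move: h; rewrite (bigD1 i) //= => h.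
  have r0 : 0 <= \sum_(j < d | j != i) (z 0 j) ^+ 2.
    by apply: sumr_ge0 => j _; exact: sqr_ge0.
  have zi1 : 1 <= z 0 i ^+ 2.
    have : 0 < z 0 i ^+ 2 by rewrite lt_neqAle eq_sym sqrf_eq0 zi sqr_ge0.
    by rewrite gtz0_ge1.
  have z2 : z 0 i ^+ 2 = 1.
    by apply/eqP; rewrite eq_le zi1 andbT -[leRHS]h lerDl.
  have : \sum_(j < d | j != i) (z 0 j) ^+ 2 == 0.
    by move: h; rewrite z2 => /eqP; rewrite -subr_eq0 addrAC subrr add0r.
  rewrite psumr_eq0 => [/allP hall|j _]; last exact: sqr_ge0.
  have zj j : j != i -> z 0 j = 0.
    move=> ji; have := hall j; rewrite mem_index_enum => /(_ isT).
    by rewrite ji /= sqrf_eq0 => /eqP.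
  exists i; move/eqP: z2; rewrite sqrf_eq1 => /orP[/eqP zi'|/eqP zi']; [left|right];
    apply/rowP => j; rewrite !mxE ?eqxx /=;
    by have [->|ji] := eqVneq j i; rewrite ?zi' // (zj _ ji) ?oppr0.
- rewrite (bigD1 i) //= big1 => [|j ji]; last by rewrite unit_vecE (negbTE ji).
  by rewrite unit_vecE eqxx.
- rewrite (bigD1 i) //= big1 => [|j ji]; last by rewrite mxE unit_vecE (negbTE ji).
  by rewrite mxE unit_vecE eqxx.
Qed.

Lemma laplacianE f x :
  laplacian f x =
  \sum_(i < d) (2 * f x - f (x + unit_vec i) - f (x - unit_vec i)).
Proof.
rewrite /laplacian.
have -> : [set y | enorm R (y - x) = 1] = [set` neighbours x].
  apply/seteqP; split=> y /=.
  - move/enorm_eq1 => [i h]; rewrite mem_cat; apply/orP.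
    case: h => h; [left|right]; apply/mapP; exists i; rewrite ?mem_enum//;
    by rewrite -h addrC subrK.
  - rewrite mem_cat => /orP[] /mapP[i _ ->]; apply/enorm_eq1; exists i;
    rewrite addrAC subrr add0r; by [left|right].
rewrite -fsbig_seq ?neighbours_uniq// big_cat /= 2!big_map !big_enum /= -big_split/=.
by apply: eq_bigr => i _; ring.
Qed.

End Neighbours.

(** * Poisson mixtures *)

Section Poissonization.
Variable R : realType.
Implicit Types (s t : R) (a b c : R^nat).

Lemma sum_triangle a b N :
  \sum_(0 <= n < N) \sum_(0 <= k < n.+1) a (n - k)%N * b k =
  \sum_(0 <= k < N) (\sum_(0 <= i < N - k) a i) * b k.
Proof.
transitivity (\sum_(0 <= n < N) \sum_(0 <= k < N | (k <= n)%N) a (n - k)%N * b k).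
  apply: eq_big_nat => n /andP[_ nN].
  rewrite [in RHS](@big_cat_nat _ _ _ n.+1) //= [X in _ + X]big_nat_cond.
  rewrite [X in _ + X]big1 ?addr0 => [|k]; last first.
    by case/andP=> /andP[h _]; rewrite leqNgt h.
  rewrite [RHS]big_mkcond; apply: eq_big_nat => k /andP[_ kn].
  by rewrite -ltnS kn.
rewrite (exchange_big_dep_nat xpredT) //=.
apply: eq_big_nat => k /andP[_ kN].
rewrite mulr_suml -[X in \sum_(X <= _ < _ | _) _](add0n).
rewrite (@big_cat_nat _ _ _ k) //=; last exact: ltnW.
rewrite big_nat_cond big1 ?add0r => [|n]; last first.
  by case/andP=> /andP[_ h]; rewrite leqNgt h.
rewrite -{1}[k]add0n big_addn.
rewrite big_mkcond; apply: eq_big_nat => i _.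
by rewrite leq_addl addnK.
Qed.

Lemma exp_coeff_cvg s : series (exp_coeff s) @ \oo --> expR s.
Proof. exact: is_cvg_series_exp_coeff. Qed.

Lemma exp_coeffDn s t n :
  exp_coeff (s + t) n = \sum_(0 <= k < n.+1) exp_coeff s (n - k)%N * exp_coeff t k.
Proof.
rewrite /exp_coeff /= exprDn mulr_suml big_mkord; apply: eq_bigr => -[k /=].
rewrite ltnS => kn _; rewrite -mulr_natl.
rewrite -(bin_fact kn) !natrM.
have f0 m : (m`!%:R : R) != 0 by rewrite pnatr_eq0 -lt0n fact_gt0.
have b0 : ('C(n, k)%:R : R) != 0 by rewrite pnatr_eq0 -lt0n bin_gt0.
by field; rewrite !f0 b0.
Qed.

(** The identity [e^{-s (1 - Q)} = e^{-s} e^{s Q}], with [c k] in the place of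
    [Q ^ k].  The partial sums of the series for the left-hand side form the
    triangular half of the product of the partial sums for [e^{-s}] and
    [e^{s Q}].  The other half is bounded by [C] times the same half for
    [e^s e^s = e^{2 s}], which tends to 0. *)
Lemma poissonization s c (C E : R) : 0 <= s -> (forall k, `|c k| <= C) ->
  series (fun k => exp_coeff s k * c k) @ \oo --> E ->
  series (fun n => (- s) ^+ n / n`!%:R *
     \sum_(k < n.+1) (-1) ^+ k * 'C(n, k)%:R * c k) @ \oo --> expR (- s) * E.
Proof.
move=> s0 cC cE.
pose b k := exp_coeff s k * c k.
have C0 : 0 <= C by apply: le_trans (cC 0%N).
apply: (@cvg_sub0 _ _ _ _ _ _ (fun N => series (exp_coeff (-s)) N * series b N)); last first.
  by apply: cvgM => //; exact: exp_coeff_cvg.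
have tri0 : (fun N => C * (series (exp_coeff s) N * series (exp_coeff s) N -
    series (exp_coeff (s + s)) N)) @ \oo --> (0 : R).
  rewrite -(mulr0 C) -(subrr (expR (s + s))) {1}expRD.
  apply: cvgMl_tmp; apply: cvgB; last exact: exp_coeff_cvg.
  by apply: cvgM; exact: exp_coeff_cvg.
apply/cvgr0Pnorm_le => /= e e0.
move/cvgr0Pnorm_le: tri0 => /(_ e e0); apply: filterS => N tN; apply: (le_trans _ tN).
apply: (le_trans _ (ler_norm _)).
have box (x y : R^nat) : series x N * series y N =
    \sum_(0 <= k < N) (\sum_(0 <= i < N - k) x i) * y k +
    \sum_(0 <= k < N) (\sum_(N - k <= i < N) x i) * y k.
  rewrite -big_split /= /series /= mulr_sumr; apply: eq_bigr => k _.
  by rewrite -mulrDl -big_cat_nat ?leq_subr.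
have -> : series (exp_coeff (s + s)) N =
    \sum_(0 <= k < N) (\sum_(0 <= i < N - k) exp_coeff s i) * exp_coeff s k.
  by rewrite -sum_triangle; apply: eq_bigr => n _; rewrite exp_coeffDn.
rewrite !fctE /=.
have -> : series (fun n => (- s) ^+ n / n`!%:R *
     \sum_(k < n.+1) (-1) ^+ k * 'C(n, k)%:R * c k) N =
    \sum_(0 <= k < N) (\sum_(0 <= i < N - k) exp_coeff (- s) i) * b k.
  rewrite -sum_triangle; apply: eq_bigr => n _.
  rewrite big_mkord mulr_sumr; apply: eq_bigr => -[k /=]; rewrite ltnS => kn _.
  rewrite /b /exp_coeff /= -(bin_fact kn) !natrM.
  have f0 m : (m`!%:R : R) != 0 by rewrite pnatr_eq0 -lt0n fact_gt0.
  have b0 : ('C(n, k)%:R : R) != 0 by rewrite pnatr_eq0 -lt0n bin_gt0.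
  have -> : (- s) ^+ n = (- s) ^+ (n - k) * ((-1) ^+ k * s ^+ k).
    by rewrite -exprMn mulN1r -exprD subnK.
  have k2 : ((-1) ^+ k) ^+ 2 = 1 :> R by rewrite sqrr_sign.
  transitivity ((- s) ^+ (n - k) / (n - k)`!%:R * (s ^+ k / k`!%:R * c k) * ((-1) ^+ k) ^+ 2).
    by field; rewrite !f0 b0.
  by rewrite k2 mulr1.
rewrite !box addrAC subrr add0r opprD addrA subrr add0r normrN.
apply: le_trans (ler_norm_sum _ _ _) _; rewrite mulr_sumr.
apply: ler_sum => k _.
rewrite normrM mulrCA; apply: ler_pM => //.
  apply: le_trans (ler_norm_sum _ _ _) _; apply: ler_sum => i _.
  by rewrite /exp_coeff /= normrM normrX normrN ger0_norm // ger0_norm.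
by rewrite /b normrM mulrC (ger0_norm (exp_coeff_ge0 _ s0)) ler_wpM2r ?cC // exp_coeff_ge0.
Qed.

End Poissonization.

(** * The lazy average *)

Section LazyWalk.
Variables (R : realType) (d : nat).
Hypothesis d_gt0 : (0 < d)%N.
Implicit Types (x y z : lattice d) (f g h : lattice d -> R).

(** The laziness 1/2 gives the weights 1/4, 1/2, 1/4 in each direction; without
    it the iterates of an indicator function would vanish at points of the wrong
    parity and could not be monotone. *)
Definition lazy_avg f : lattice d -> R := fun x =>
  (4 * d%:R)^-1 *
  \sum_(i < d) (2 * f x + f (x + unit_vec i) + f (x - unit_vec i)).

Let dR_neq0 : (d%:R : R) != 0. Proof. by rewrite pnatr_eq0 -lt0n. Qed.

Lemma lazy_avg_eq f g : f =1 g -> lazy_avg f =1 lazy_avg g.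
Proof.
by move=> fg x; congr (_ * _); apply: eq_bigr => i _; rewrite !fg.
Qed.

Lemma iter_lazy_eq k f g : f =1 g -> iter k lazy_avg f =1 iter k lazy_avg g.
Proof. by move=> /funext ->. Qed.

Lemma lazy_avg_sum (I : Type) (r : seq I) (a : I -> R) (g : I -> lattice d -> R) x :
  lazy_avg (fun y => \sum_(j <- r) a j * g j y) x =
  \sum_(j <- r) a j * lazy_avg (g j) x.
Proof.
elim: r => [|j r IH].
  rewrite /lazy_avg !big_nil big1 ?mulr0// => i _; rewrite !big_nil; ring.
rewrite big_cons -IH /lazy_avg mulrCA -mulrDr; congr (_ * _).
rewrite [X in _ = X + _]mulr_sumr -big_split /=; apply: eq_bigr => i _.
by rewrite !big_cons; ring.
Qed.

Lemma iter_lazy_sum k (I : Type) (r : seq I) (a : I -> R) (g : I -> lattice d -> R) x :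
  iter k lazy_avg (fun y => \sum_(j <- r) a j * g j y) x =
  \sum_(j <- r) a j * iter k lazy_avg (g j) x.
Proof.
elim: k x => [//|k IH] x; rewrite !iterS (lazy_avg_eq IH).
by rewrite lazy_avg_sum; apply: eq_bigr => j _; rewrite iterS.
Qed.

Lemma iter_lazy_lin k (a b : R) f g x :
  iter k lazy_avg (fun y => a * f y + b * g y) x =
  a * iter k lazy_avg f x + b * iter k lazy_avg g x.
Proof.
rewrite (iter_lazy_eq k (g := fun y => \sum_(j <- [:: true; false])
   (if j then a else b) * (if j then f else g) y)).
  by rewrite iter_lazy_sum !big_cons big_nil addr0.
by move=> y; rewrite !big_cons big_nil addr0.
Qed.

Lemma lazy_avg_le f g : (forall x, f x <= g x) -> forall x, lazy_avg f x <= lazy_avg g x.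
Proof.
move=> fg x; apply: ler_wpM2l; first by rewrite invr_ge0 mulr_ge0.
by apply: ler_sum => i _; rewrite !lerD // ler_wpM2l.
Qed.

Lemma iter_lazy_le k f g : (forall x, f x <= g x) ->
  forall x, iter k lazy_avg f x <= iter k lazy_avg g x.
Proof. by move=> fg; elim: k => [//|k IH]; exact: lazy_avg_le. Qed.

Lemma lazy_avg_cst (c : R) x : lazy_avg (fun=> c) x = c.
Proof.
rewrite /lazy_avg sumr_const card_ord -mulr_natl.
by field; rewrite dR_neq0.
Qed.

Lemma iter_lazy_cst k (c : R) x : iter k lazy_avg (fun=> c) x = c.
Proof.
by elim: k x => [//|k IH] x; rewrite iterS (lazy_avg_eq IH) lazy_avg_cst.
Qed.

Lemma iter_lazy_translate k f a x :
  iter k lazy_avg (fun y => f (y + a)) x = iter k lazy_avg f (x + a).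
Proof.
elim: k x => [//|k IH] x; rewrite !iterS (lazy_avg_eq IH).
by congr (_ * _); apply: eq_bigr => i _; rewrite ![x + _ + a]addrAC.
Qed.

Definition norm_sq x : R := \sum_(i < d) (x 0 i)%:~R ^+ 2.

Lemma norm_sq_ge0 x : 0 <= norm_sq x.
Proof. by apply: sumr_ge0 => i _; exact: sqr_ge0. Qed.

Lemma lazy_avg_norm_sq x : lazy_avg norm_sq x = norm_sq x + 2^-1.
Proof.
rewrite /lazy_avg (eq_bigr (fun=> 4 * norm_sq x + 2)) => [|i _].
  by rewrite sumr_const card_ord -mulr_natl; field; rewrite dR_neq0.
rewrite /norm_sq (bigD1 i)//= [X in _ + X + _](bigD1 i)//= [X in _ + _ + X](bigD1 i)//=.
under [X in _ + (_ + X) + _]eq_bigr => j ji.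
  rewrite !mxE (negbTE ji) andbF addr0; over.
under [X in _ + (_ + _) + (_ + X)]eq_bigr => j ji.
  rewrite !mxE (negbTE ji) andbF oppr0 addr0; over.
by rewrite !mxE !eqxx /= rmorphD rmorphB /=; ring.
Qed.

Lemma iter_lazy_norm_sq k x : iter k lazy_avg norm_sq x = norm_sq x + k%:R / 2.
Proof.
elim: k x => [|k IH] x; first by rewrite mul0r addr0.
have -> : iter k.+1 lazy_avg norm_sq x = iter k lazy_avg (lazy_avg norm_sq) x by rewrite iterSr.
rewrite (iter_lazy_eq _ (g := fun y => \sum_(j <- [:: true; false])
   1 * (if j then norm_sq y else 2^-1))); last first.
  by move=> y; rewrite lazy_avg_norm_sq !big_cons big_nil !mul1r addr0.
rewrite iter_lazy_sum !big_cons big_nil iter_lazy_cst (iter_lazy_eq _ (g := norm_sq))//.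
by rewrite IH -natr1; field.
Qed.

Lemma laplacian_lazy f x : laplacian f x = 4 * d%:R * (f x - lazy_avg f x).
Proof.
rewrite laplacianE /lazy_avg mulrBr mulrA mulfV ?mul1r; last by rewrite mulf_neq0.
rewrite (eq_bigr (fun i => 4 * f x -
  (2 * f x + f (x + unit_vec i) + f (x - unit_vec i)))) => [|i _]; last by ring.
rewrite sumrB sumr_const card_ord -mulr_natl; congr (_ - _); ring.
Qed.

(** The binomial formula for [L = 4 d (1 - Q)], with [Q] the lazy average. *)
Lemma iter_laplacian n f x :
  iter n (@laplacian R d) f x = (4 * d%:R) ^+ n *
    \sum_(k < n.+1) (-1) ^+ k * 'C(n, k)%:R * iter k lazy_avg f x.
Proof.
elim: n f x => [|n IH] f x.
  by rewrite big_ord_recl big_ord0 bin0 /= !expr0 !mul1r addr0.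
rewrite iterSr IH exprSr -mulrA; congr (_ * _).
rewrite (eq_bigr (fun k : 'I_n.+1 => 4 * d%:R * ((-1) ^+ k * 'C(n, k)%:R *
   (iter k lazy_avg f x - iter k.+1 lazy_avg f x)))); last first.
  move=> k _; rewrite -mulrCA; congr (_ * _).
  rewrite (iter_lazy_eq _ (g := fun y => \sum_(j <- [:: true; false])
   (4 * d%:R) * (-1) ^+ (~~ j) * (if j then f y else lazy_avg f y))); last first.
    by move=> y; rewrite laplacian_lazy !big_cons big_nil /=; ring.
  by rewrite iter_lazy_sum !big_cons big_nil /= -iterSr /=; ring.
rewrite -mulr_sumr; congr (_ * _).
rewrite [RHS]big_ord_recl /= bin0 expr0 !mul1r.
under eq_bigr do rewrite mulrBr.
rewrite sumrB big_ord_recl /= bin0 expr0 !mul1r -addrA; congr (_ + _).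
rewrite [X in _ - X]big_ord_recr [in RHS]big_ord_recr /=.
rewrite /bump /= !add1n !binn add0n opprD addrA; congr (_ + _); last first.
  by rewrite exprS; ring.
rewrite -sumrB; apply: eq_bigr => i _.
by rewrite !add1n binS natrD exprS add0n; ring.
Qed.

(** Evenness in each coordinate is part of the notion, as equal absolute values
    give both inequalities. *)
Definition coord_decreasing f :=
  forall x y, (forall i, `|x 0 i| <= `|y 0 i|) -> f y <= f x.

(** One direction [i] is considered at a time.  If [|x i| = |y i|] the neighbours
    of the two points correspond to each other, possibly in the opposite order.
    If [|x i| < |y i|] the comparison is crosswise: [y] lies at least as far out
    as both neighbours of [x], and both neighbours of [y] at least as far out
    as [x]. *)
Lemma lazy_avg_decreasing f : coord_decreasing f -> coord_decreasing (lazy_avg f).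
Proof.
move=> fd x y xy; apply: ler_wpM2l; first by rewrite invr_ge0 mulr_ge0.
apply: ler_sum => i _.
have cmp z z' : (forall j, j != i -> `|z 0 j| <= `|z' 0 j|) -> `|z 0 i| <= `|z' 0 i| ->
    f z' <= f z.
  by move=> zj zi; apply: fd => j; have [->|/zj] := eqVneq j i.
have pj z j : j != i -> (z + unit_vec i) 0 j = z 0 j.
  by move=> ji; rewrite add_unit_vecE (negbTE ji) addr0.
have mj z j : j != i -> (z - unit_vec i) 0 j = z 0 j.
  by move=> ji; rewrite sub_unit_vecE (negbTE ji) subr0.
have pi z : (z + unit_vec i) 0 i = z 0 i + 1 by rewrite add_unit_vecE eqxx.
have mi z : (z - unit_vec i) 0 i = z 0 i - 1 by rewrite sub_unit_vecE eqxx.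
have nbr_le z z' : z \in [:: x; x + unit_vec i; x - unit_vec i] ->
    z' \in [:: y; y + unit_vec i; y - unit_vec i] ->
    `|z 0 i| <= `|z' 0 i| -> f z' <= f z.
  move=> hz hz'; apply: cmp => j ji; have {xy} := xy j.
  by move: hz hz'; rewrite !inE => /or3P[] /eqP-> /or3P[] /eqP->; rewrite ?pj ?mj.
have xyi := xy i.
have [e|[e|e]] : y 0 i = x 0 i \/ y 0 i = - x 0 i \/ `|x 0 i| < `|y 0 i| by lia.
- apply: lerD; first apply: lerD; first apply: ler_wpM2l => //;
  by apply: nbr_le; rewrite ?inE ?eqxx ?orbT// ?pi ?mi; lia.
- rewrite -2!addrA [X in _ <= _ + X]addrC; apply: lerD; last apply: lerD; first apply: ler_wpM2l => //;
  by apply: nbr_le; rewrite ?inE ?eqxx ?orbT// ?pi ?mi; lia.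
- have -> : 2 * f y + f (y + unit_vec i) + f (y - unit_vec i) =
    (f (y + unit_vec i) + f (y - unit_vec i)) + (f y + f y) by ring.
  have -> : 2 * f x + f (x + unit_vec i) + f (x - unit_vec i) =
    (f x + f x) + (f (x + unit_vec i) + f (x - unit_vec i)) by ring.
  by apply: lerD; apply: lerD; apply: nbr_le; rewrite ?inE ?eqxx ?orbT// ?pi ?mi; lia.
Qed.

End LazyWalk.

(** * The heat kernel *)

Section HeatKernel.
Variables (R : realType) (d : nat).
Hypothesis d_gt0 : (0 < d)%N.
Implicit Types (x y z : lattice d) (f g h : lattice d -> R) (t : R).

Lemma bounded_exp_cvg (s : R) (c : R^nat) (C : R) : 0 <= s -> (forall k, `|c k| <= C) ->
  cvgn (series (fun k => exp_coeff s k * c k)).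
Proof.
move=> s0 cC; apply: normed_cvg.
apply: (@series_le_cvg _ _ (fun k => C * exp_coeff s k)).
- by move=> k; exact: normr_ge0.
- by move=> k; rewrite mulr_ge0 ?exp_coeff_ge0 // (le_trans _ (cC 0%N)).
- move=> k; rewrite /= normrM mulrC (ger0_norm (exp_coeff_ge0 _ s0)).
  by rewrite ler_wpM2r ?exp_coeff_ge0.
- by apply: (@is_cvg_seriesZ _ (exp_coeff s) C); exact: is_cvg_series_exp_coeff.
Qed.

Lemma indic_set1E y z : \1_[set y] z = (z == y)%:R :> R.
Proof.
by rewrite indicE; congr (_%:R); congr nat_of_bool; apply/idP/eqP; rewrite inE.
Qed.

Definition walk k : lattice d -> R := iter k (@lazy_avg R d) \1_[set 0].

Lemma iter_lazy_indic k y x : iter k (@lazy_avg R d) \1_[set y] x = walk k (x - y).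
Proof.
rewrite /walk -iter_lazy_translate; apply: iter_lazy_eq => z.
by rewrite !indic_set1E subr_eq0.
Qed.

Lemma walk_ge0 k z : 0 <= walk k z.
Proof.
rewrite -(iter_lazy_cst d_gt0 k 0 z); apply: iter_lazy_le => y.
by rewrite indicE.
Qed.

Lemma walk_le1 k z : walk k z <= 1.
Proof.
rewrite -(iter_lazy_cst d_gt0 k 1 z); apply: iter_lazy_le => y.
by rewrite indicE; case: (_ \in _).
Qed.

Lemma walk_decreasing k : coord_decreasing (walk k).
Proof.
elim: k => [|k IH]; last exact: lazy_avg_decreasing.
move=> x y xy; rewrite /walk /= !indic_set1E.
have [y0|] := eqVneq y 0; last by case: (_ == _).
suff -> : x = 0 by rewrite eqxx.
apply/rowP => i; have := xy i; rewrite y0 !mxE normr0 normr_le0.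
by move/eqP.
Qed.

Lemma coord_decreasing_even f z : coord_decreasing f -> f (- z) = f z.
Proof.
move=> fd; apply/eqP; rewrite eq_le; apply/andP; split;
by apply: fd => i; rewrite mxE normrN.
Qed.

(** The kernel of [e^{-tL}], as the mixture of the steps of the walk with Poisson
    weights of mean [4 d t]. *)
Definition heat_kernel t z : R := expR (- (4 * d%:R * t)) *
  limn (series (fun k => exp_coeff (4 * d%:R * t) k * walk k z)).

Let s_ge0 t : 0 <= t -> 0 <= 4 * d%:R * t.
Proof. by move=> t0; rewrite !mulr_ge0. Qed.

Lemma walk_exp_cvg t z : 0 <= t ->
  series (fun k => exp_coeff (4 * d%:R * t) k * walk k z) @ \oo -->
  expR (4 * d%:R * t) * heat_kernel t z.
Proof.
move=> t0; rewrite /heat_kernel mulrA -expRD subrr expR0 mul1r.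
apply: (@bounded_exp_cvg _ _ 1); first exact: s_ge0.
by move=> k; rewrite ger0_norm ?walk_le1 ?walk_ge0.
Qed.

Lemma heat_indic t x y : 0 <= t -> heat t \1_[set y] x = heat_kernel t (x - y).
Proof.
move=> t0; rewrite /heat /heat_kernel.
apply/cvg_lim => //.
have := @poissonization R (4 * d%:R * t) (fun k => walk k (x - y)) 1
  (limn (series (fun k => exp_coeff (4 * d%:R * t) k * walk k (x - y)))) (s_ge0 t0).
rewrite (_ : (fun n => (- (4 * d%:R * t)) ^+ n / n`!%:R * _) =
   (fun n => (- t) ^+ n / n`!%:R * iter n (@laplacian R d) \1_[set y] x)).
  apply.
    by move=> k; rewrite ger0_norm ?walk_le1 ?walk_ge0.
  apply: (@bounded_exp_cvg _ _ 1); first exact: s_ge0.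
  by move=> k; rewrite ger0_norm ?walk_le1 ?walk_ge0.
apply/funext => n; rewrite iter_laplacian // [RHS]mulrA; congr (_ * _).
  by rewrite [RHS]mulrAC -exprMn; congr (_ ^+ _ / _); ring.
by apply: eq_bigr => k _; rewrite iter_lazy_indic.
Qed.

Lemma exp_series_sum (s : R) (I : Type) (r : seq I) (a l : I -> R) (c : I -> R^nat) :
  (forall j, series (fun k => exp_coeff s k * c j k) @ \oo --> l j) ->
  series (fun k => exp_coeff s k * \sum_(j <- r) a j * c j k) @ \oo -->
  \sum_(j <- r) a j * l j.
Proof.
move=> cl; elim: r => [|j r IH].
  rewrite big_nil; apply: cvg_near_cst; apply: nearW => n.
  by rewrite /series /= big1 // => i _; rewrite big_nil mulr0.
rewrite big_cons.
rewrite (_ : series _ = (fun n => a j * series (fun k => exp_coeff s k * c j k) n +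
   series (fun k => exp_coeff s k * \sum_(j <- r) a j * c j k) n)).
  by apply: cvgD => //; apply: cvgMl_tmp.
apply/funext => n; rewrite /series /= mulr_sumr -big_split /=.
by apply: eq_bigr => k _; rewrite big_cons; ring.
Qed.

Lemma exp_series_lin (s a b l m : R) (u v : R^nat) :
  series (fun k => exp_coeff s k * u k) @ \oo --> l ->
  series (fun k => exp_coeff s k * v k) @ \oo --> m ->
  series (fun k => exp_coeff s k * (a * u k + b * v k)) @ \oo --> a * l + b * m.
Proof.
move=> ul vm; have := @exp_series_sum s bool [:: true; false]
  (fun j => if j then a else b) (fun j => if j then l else m) (fun j => if j then u else v).
rewrite !big_cons big_nil addr0.
rewrite (_ : (fun k => _ * \sum_(_ <- _) _) = (fun k => exp_coeff s k * (a * u k + b * v k))).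
  by apply; case.
by apply/funext => k; rewrite !big_cons big_nil addr0.
Qed.

Lemma walk_exp_sum_cvg t (F : seq (lattice d)) (g : lattice d -> R) : 0 <= t ->
  series (fun k => exp_coeff (4 * d%:R * t) k * \sum_(z <- F) g z * walk k z) @ \oo -->
  expR (4 * d%:R * t) * \sum_(z <- F) g z * heat_kernel t z.
Proof.
move=> t0; rewrite mulr_sumr; under eq_bigr do rewrite mulrCA.
by apply: exp_series_sum => z; exact: walk_exp_cvg.
Qed.

Lemma exp_series_le (s : R) (a b : R^nat) (A B : R) : 0 <= s ->
  (forall k, a k <= b k) ->
  series (fun k => exp_coeff s k * a k) @ \oo --> A ->
  series (fun k => exp_coeff s k * b k) @ \oo --> B -> A <= B.
Proof.
move=> s0 ab cA cB; apply: (ler_cvg_to cA cB); apply: nearW => n.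
by apply: ler_sum => k _; rewrite ler_wpM2l ?exp_coeff_ge0.
Qed.

Lemma exp_series_cst (s c : R) : series (fun k => exp_coeff s k * c) @ \oo --> expR s * c.
Proof.
rewrite (_ : series _ = (fun n => series (exp_coeff s) n * c)).
  by apply: cvgMr_tmp; exact: exp_coeff_cvg.
by apply/funext => n; rewrite /series /= mulr_suml.
Qed.

Lemma exp_series_geom (s l : R) : series (fun k => exp_coeff s k * l ^+ k) @ \oo --> expR (s * l).
Proof.
rewrite (_ : (fun k => _) = exp_coeff (s * l)); first exact: exp_coeff_cvg.
by apply/funext => k; rewrite /exp_coeff /= exprMn mulrAC.
Qed.

Lemma exp_series_id (s : R) : series (fun k => exp_coeff s k * k%:R) @ \oo --> s * expR s.
Proof.
rewrite -(cvg_shiftS (series _)).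
rewrite (_ : (fun n => _) = (fun n => s * series (exp_coeff s) n)).
  by apply: cvgMl_tmp; exact: exp_coeff_cvg.
apply/funext => n; rewrite /series /= big_nat_recl // mulr0 add0r mulr_sumr.
apply: eq_bigr => k _; rewrite /exp_coeff /= factS natrM exprS.
have f0 : (k`!%:R : R) != 0 by rewrite pnatr_eq0 -lt0n fact_gt0.
have k0 : (k.+1%:R : R) != 0 by rewrite pnatr_eq0.
by field; rewrite nat1r k0 f0.
Qed.

(** Since [walk k] is even, its value at [z] is the value at 0 of the iterate of
    the indicator function of [z].  Hence a pointwise bound for a finite sum of
    indicator functions passes, by positivity of the average, to a bound for the
    sum against the walk. *)
Lemma sum_walk k (F : seq (lattice d)) (g : lattice d -> R) :
  \sum_(z <- F) g z * walk k z =
  iter k (@lazy_avg R d) (fun y => \sum_(z <- F) g z * \1_[set z] y) 0.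
Proof.
rewrite iter_lazy_sum; apply: eq_bigr => z _.
rewrite iter_lazy_indic sub0r coord_decreasing_even //; exact: walk_decreasing.
Qed.

Lemma sum_indic (F : seq (lattice d)) (g : lattice d -> R) y : uniq F ->
  \sum_(z <- F) g z * \1_[set z] y = if y \in F then g y else 0.
Proof.
move=> uF; case: ifPn => yF.
  rewrite (bigD1_seq y) //= big1_seq => [|z /andP[zy _]].
    by rewrite indic_set1E eqxx mulr1 addr0.
  by rewrite indic_set1E eq_sym (negbTE zy) mulr0.
rewrite big1_seq // => z /andP[_ zF]; rewrite indic_set1E.
by case: eqP zF yF => [->->//|_ _ _]; rewrite mulr0.
Qed.

Lemma heat_kernel_ge0 t z : 0 <= t -> 0 <= heat_kernel t z.
Proof.
move=> t0; rewrite -(pmulr_rge0 _ (expR_gt0 (4 * d%:R * t))).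
apply: (@exp_series_le (4 * d%:R * t) (fun=> 0) (walk ^~ z)) => [|||].
- exact: s_ge0.
- by move=> k; exact: walk_ge0.
- by have := @exp_series_cst (4 * d%:R * t) 0; rewrite mulr0.
- exact: walk_exp_cvg.
Qed.

Lemma heat_kernel_decreasing t : 0 <= t -> coord_decreasing (heat_kernel t).
Proof.
move=> t0 x y xy; rewrite -(ler_pM2l (expR_gt0 (4 * d%:R * t))).
apply: (@exp_series_le (4 * d%:R * t) (walk ^~ y) (walk ^~ x)).
- exact: s_ge0.
- by move=> k; exact: walk_decreasing.
- exact: walk_exp_cvg.
- exact: walk_exp_cvg.
Qed.

Lemma heat_kernel_mass t (F : seq (lattice d)) (g : lattice d -> R) : 0 <= t ->
  uniq F -> (forall z, 0 <= g z <= 1) -> \sum_(z <- F) g z * heat_kernel t z <= 1.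
Proof.
move=> t0 uF g01; rewrite -(ler_pM2l (expR_gt0 (4 * d%:R * t))).
apply: (@exp_series_le _ (fun k => \sum_(z <- F) g z * walk k z) (fun=> 1) _ _ (s_ge0 t0));
  [|exact: walk_exp_sum_cvg|exact: exp_series_cst].
move=> k; rewrite sum_walk -(iter_lazy_cst d_gt0 k 1 0); apply: iter_lazy_le => y.
by rewrite sum_indic //; case: ifP => // _; case/andP: (g01 y).
Qed.

Lemma heat_kernel_second_moment t (F : seq (lattice d)) (g : lattice d -> R) (c : R) : 0 <= t ->
  uniq F -> 0 <= c -> (forall z, g z <= c * norm_sq R z) ->
  \sum_(z <- F) g z * heat_kernel t z <= 2 * d%:R * t * c.
Proof.
move=> t0 uF c0 gc; rewrite -(ler_pM2l (expR_gt0 (4 * d%:R * t))).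
have cv : series (fun k => exp_coeff (4 * d%:R * t) k * (k%:R * (c / 2))) @ \oo -->
    expR (4 * d%:R * t) * (2 * d%:R * t * c).
  rewrite (_ : series _ = (fun n => series (fun k => exp_coeff (4 * d%:R * t) k * k%:R) n * (c / 2))).
    rewrite (_ : expR _ * _ = 4 * d%:R * t * expR (4 * d%:R * t) * (c / 2)); last by field.
    by apply: cvgMr_tmp; exact: exp_series_id.
  by apply/funext => n; rewrite /series /= mulr_suml; apply: eq_bigr => k _; rewrite mulrA.
apply: (@exp_series_le _ (fun k => \sum_(z <- F) g z * walk k z) _ _ _ (s_ge0 t0) _ _ cv);
  last exact: walk_exp_sum_cvg.
move=> k; rewrite sum_walk.
have -> : k%:R * (c / 2) = iter k (@lazy_avg R d) (fun y => \sum_(j <- [:: tt]) c * norm_sq R y) 0.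
  rewrite iter_lazy_sum big_cons big_nil addr0 iter_lazy_norm_sq //.
  rewrite /norm_sq big1 => [|i _]; last by rewrite mxE expr0n.
  by field.
apply: iter_lazy_le => y; rewrite sum_indic // big_cons big_nil addr0.
by case: ifP => // _; rewrite mulr_ge0 // norm_sq_ge0.
Qed.

End HeatKernel.

(** * Boxes and the lower bound for the heat kernel *)

Section Boxes.
Variables (d : nat).
Implicit Types (x y z : lattice d).

Definition sup_norm x : nat := \max_(i < d) absz (x 0%R i).

Lemma sup_norm_leP x (n : nat) : reflect (forall i, (absz (x 0%R i) <= n)%N) (sup_norm x <= n)%N.
Proof.
by apply: (iffP (bigmax_leqP _ _ _)) => [h i|h i _]; exact: h.
Qed.

Lemma le_sup_norm x i : (absz (x 0%R i) <= sup_norm x)%N.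
Proof. exact: (@leq_bigmax _ (fun i => absz (x 0 i))). Qed.

Lemma sup_normB x y : (sup_norm x <= sup_norm (x - y) + sup_norm y)%N.
Proof.
apply/sup_norm_leP => i.
apply: leq_trans (leq_add (le_sup_norm (x - y) i) (le_sup_norm y i)).
rewrite !mxE; move: (x 0 i) (y 0 i) => a b. lia.
Qed.

Lemma sup_normN x : sup_norm (- x) = sup_norm x.
Proof. by apply: eq_bigr => i _; rewrite mxE abszN. Qed.

Definition box (n : nat) : seq (lattice d) :=
  [seq \row_i ((nat_of_ord (f i))%:Z - n%:Z) | f : {ffun 'I_d -> 'I_(2 * n).+1} <- enum {ffun 'I_d -> 'I_(2 * n).+1}].

Lemma box_uniq n : uniq (box n).
Proof.
rewrite map_inj_uniq ?enum_uniq // => f g /rowP fg; apply/ffunP => i.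
by apply: val_inj; have := fg i; rewrite !mxE /=; lia.
Qed.

Lemma mem_box n x : (x \in box n) = (sup_norm x <= n)%N.
Proof.
apply/mapP/sup_norm_leP => [[f _ ->] i|h].
  rewrite mxE; move: (ltn_ord (f i)); move: (nat_of_ord _) => a. lia.
have hi i : (absz (x 0 i + n%:Z)%R < (2 * n).+1)%N by have := h i; lia.
exists [ffun i => Ordinal (hi i)]; first by rewrite mem_enum.
by apply/rowP => i; rewrite mxE ffunE /=; have := h i; lia.
Qed.

Lemma size_box n : size (box n) = ((2 * n).+1 ^ d)%N.
Proof. by rewrite size_map -cardE card_ffun !card_ord. Qed.

End Boxes.

Section LowerBound.
Variables (R : realType) (d : nat).
Hypothesis d_gt0 : (0 < d)%N.
Implicit Types (x y z : lattice d) (f g h : lattice d -> R) (t : R).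

Let dR_neq0 : (d%:R : R) != 0. Proof. by rewrite pnatr_eq0 -lt0n. Qed.

Definition cos_prod (th : R) (S : {set 'I_d}) x : R :=
  \prod_(i in S) cos (th * (x 0 i)%:~R).

Lemma lazy_avg_cos_prod th S x : lazy_avg (cos_prod th S) x =
  (1 - #|S|%:R * (2 - 2 * cos th) / (4 * d%:R)) * cos_prod th S x.
Proof.
rewrite /lazy_avg (eq_bigr (fun i => 4 * cos_prod th S x -
  (if i \in S then (2 - 2 * cos th) * cos_prod th S x else 0))) => [|i _]; last first.
  have pj z j : j != i -> (z + unit_vec i) 0 j = z 0 j.
    by move=> ji; rewrite add_unit_vecE (negbTE ji) addr0.
  have mj z j : j != i -> (z - unit_vec i) 0 j = z 0 j.
    by move=> ji; rewrite sub_unit_vecE (negbTE ji) subr0.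
  have pi z : (z + unit_vec i) 0 i = z 0 i + 1 by rewrite add_unit_vecE eqxx.
  have mi z : (z - unit_vec i) 0 i = z 0 i - 1 by rewrite sub_unit_vecE eqxx.
  case: ifPn => iS; last first.
    have -> : cos_prod th S (x + unit_vec i) = cos_prod th S x.
      apply: eq_bigr => j jS; rewrite pj //.
      by apply: contraNneq iS => <-.
    have -> : cos_prod th S (x - unit_vec i) = cos_prod th S x.
      apply: eq_bigr => j jS; rewrite mj //.
      by apply: contraNneq iS => <-.
    by ring.
  rewrite /cos_prod !(bigD1 i iS) /=.
  under [X in 2 * _ + _ * X + _]eq_bigr => j /andP[_ ji] do rewrite pj //.
  under [X in 2 * _ + _ + _ * X]eq_bigr => j /andP[_ ji] do rewrite mj //.
  rewrite pi mi rmorphD rmorphB /= mulrDr mulrBr mulr1 cosD cosB.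
  by ring.
rewrite sumrB sumr_const card_ord -big_mkcond sumr_const -[_ *+ d]mulr_natl -[_ *+ #|_|]mulr_natl.
by field; rewrite dR_neq0.
Qed.

Lemma iter_lazy_cos_prod th S k x : iter k (@lazy_avg R d) (cos_prod th S) x =
  (1 - #|S|%:R * (2 - 2 * cos th) / (4 * d%:R)) ^+ k * cos_prod th S x.
Proof.
elim: k x => [|k IH] x; first by rewrite mul1r.
rewrite iterS (lazy_avg_eq (g := fun y => \sum_(j <- [:: tt])
  (1 - #|S|%:R * (2 - 2 * cos th) / (4 * d%:R)) ^+ k * cos_prod th S y)).
  by rewrite lazy_avg_sum big_cons big_nil addr0 lazy_avg_cos_prod exprSr mulrA.
by move=> y; rewrite big_cons big_nil addr0 IH.
Qed.

Definition versine_prod (th : R) x : R := \prod_(i < d) (1 - cos (th * (x 0 i)%:~R)).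

(** An expansion into eigenfunctions of the lazy average. *)
Lemma versine_prodE th x : versine_prod th x =
  \sum_(S : {set 'I_d}) (-1) ^+ #|S| * cos_prod th S x.
Proof.
rewrite /versine_prod; under eq_bigr do rewrite addrC.
rewrite bigA_distr; apply: eq_bigr => S _.
by rewrite -big_mkcond /= prodrN.
Qed.

(** The mean of [versine_prod] under the heat kernel is that of a product of
    independent factors, [cos (th * x_i)] having mean [e^{- t (2 - 2 cos th)}]. *)
Lemma versine_prod_exp_cvg th t :
  series (fun k => exp_coeff (4 * d%:R * t) k *
     iter k (@lazy_avg R d) (versine_prod th) 0) @ \oo -->
  expR (4 * d%:R * t) * (1 - expR (- (t * (2 - 2 * cos th)))) ^+ d.
Proof.
set mu := 2 - 2 * cos th.
have -> : expR (4 * d%:R * t) * (1 - expR (- (t * mu))) ^+ d =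
   \sum_(S : {set 'I_d}) (-1) ^+ #|S| *
      expR (4 * d%:R * t * (1 - #|S|%:R * mu / (4 * d%:R))).
  rewrite -[X in _ ^+ X]card_ord -prodr_const.
  under eq_bigr do rewrite addrC.
  rewrite bigA_distr mulr_sumr; apply: eq_bigr => S _.
  rewrite -big_mkcond /= prodrN mulrCA prodr_const -expRM_natl -expRD; congr (_ * expR _).
  by rewrite -mulr_natl; field.
rewrite (_ : (fun k => _) = (fun k => exp_coeff (4 * d%:R * t) k *
  \sum_(S : {set 'I_d}) (-1) ^+ #|S| * (1 - #|S|%:R * mu / (4 * d%:R)) ^+ k)).
  by apply: exp_series_sum => S; exact: exp_series_geom.
apply/funext => k; congr (_ * _).
rewrite (iter_lazy_eq k (g := fun y => \sum_(S : {set 'I_d}) (-1) ^+ #|S| * cos_prod th S y)).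
  rewrite iter_lazy_sum; apply: eq_bigr => S _; rewrite iter_lazy_cos_prod.
  by rewrite /cos_prod big1 ?mulr1 // => i _; rewrite mxE mulr0 cos0.
by move=> y; rewrite versine_prodE.
Qed.

Lemma norm_sinM_le (a : R) (n : nat) : `|sin (a * n%:R)| <= n%:R * `|sin a|.
Proof.
elim: n => [|n IH]; first by rewrite mulr0 sin0 normr0 mul0r.
rewrite -natr1 mulrDr mulr1 sinD mulrDl mul1r.
apply: le_trans (ler_normD _ _) _; rewrite !normrM; apply: lerD.
  by rewrite -[leRHS]mulr1; apply: ler_pM => //; exact: cos_max.
by rewrite -[leRHS]mul1r; apply: ler_pM => //; exact: cos_max.
Qed.

Lemma versineE (a : R) : 1 - cos (a * 2) = 2 * `|sin a| ^+ 2.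
Proof.
rewrite mulr_natr mulr2n cosD -!expr2 cos2sin2 real_normK ?num_real //.
by ring.
Qed.

(** By the half-angle formula this is [|sin (n a)| <= n |sin a|]. *)
Lemma versine_le (th : R) (n : int) :
  1 - cos (th * n%:~R) <= n%:~R ^+ 2 * (1 - cos th).
Proof.
have -> : n%:~R ^+ 2 = (absz n)%:R ^+ 2 :> R.
  by rewrite natr_absz intr_norm real_normK ?num_real.
have -> : cos (th * n%:~R) = cos (th / 2 * (absz n)%:R * 2).
  have [n0|n0] := leP 0 n.
    by rewrite -{1}(gez0_abs n0) -pmulrn; congr cos; field.
  rewrite -cosN -{1}[n]opprK -(lez0_abs (ltW n0)) rmorphN /= -pmulrn.
  by congr cos; field.
have -> : cos th = cos (th / 2 * 2) by rewrite divfK.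
rewrite !versineE [leRHS]mulrCA ler_pM2l // -exprMn lerXn2r ?nnegrE ?mulr_ge0 //.
exact: norm_sinM_le.
Qed.

Lemma norm_sq_ge_sup x : (sup_norm x)%:R ^+ 2 <= norm_sq R x.
Proof.
have [i ->] : exists i, sup_norm x = absz (x 0 i).
  have [|i xi] := @bigop.eq_bigmax 'I_d (fun i => absz (x 0 i)); first by rewrite card_ord.
  by exists i.
rewrite natr_absz intr_norm real_normK ?num_real // /norm_sq (bigD1 i) //=.
by rewrite lerDl; apply: sumr_ge0 => j _; exact: sqr_ge0.
Qed.

Lemma versine_prod_le th x i :
  versine_prod th x <= 2 ^+ d.-1 * (1 - cos (th * (x 0 i)%:~R)).
Proof.
rewrite /versine_prod (bigD1 i) //= mulrC; apply: ler_wpM2r.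
  by rewrite subr_ge0 cos_le1.
have -> : d.-1 = #|[pred j : 'I_d | j != i]|.
  by rewrite -[in LHS](card_ord d) (cardD1 i) /=; apply: eq_card => j; rewrite !inE andbT.
rewrite -prodr_const; apply: ler_prod => j _.
by rewrite subr_ge0 cos_le1 /= lerBlDr -lerBlDl; have := cos_geN1 (th * (x 0 j)%:~R); lra.
Qed.

(** With [cos th = 1 - 1 / (2 t)], [versine_prod th] has mean
    [(1 - 1/e) ^ d >= 2 ^ (- d)] at time [t].  It is at most [2 ^ d], it is of
    order [m ^ 2 / t] where some coordinate is smaller than [m], and the region
    where some coordinate exceeds [M] has mass of order [t / M ^ 2].  For small
    ratios, a fixed part of the mean comes from the points whose coordinates all
    lie between [m] and [M], and there the kernel is at most its value at [x]. *)
Lemma heat_kernel_lower t (m M : nat) x : (0 < m)%N ->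
  4 ^+ d * m%:R ^+ 2 <= t -> 8 * d%:R * 4 ^+ d * t <= M%:R ^+ 2 ->
  (sup_norm x <= m)%N ->
  1 <= 2 * 4 ^+ d * (2 * M).+1%:R ^+ d * heat_kernel t x.
Proof.
move=> m0 mt tM xm.
have m1 : 1 <= m%:R :> R by rewrite ler1n.
have p4 : 4 <= 4 ^+ d :> R by rewrite -[leLHS]expr1 ler_eXn2l // ltr1n.
have t1 : 1 <= t.
  apply: le_trans mt; rewrite -[leLHS]mulr1; apply: ler_pM => //; first by lra.
  by rewrite expr_ge1.
have t0 : 0 <= t by lra.
have t_gt0 : 0 < t by lra.
pose th := acos (1 - (2 * t)^-1).
have cth : cos th = 1 - (2 * t)^-1.
  rewrite /th acosK // in_itv /=.
  have : 0 < (2 * t)^-1 by rewrite invr_gt0; lra.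
  have : (2 * t)^-1 <= 1 by rewrite invf_le1; lra.
  by lra.
(* [g] marks the points all of whose coordinates are at least [m], so that the
   kernel there is at most its value at [x]. *)
pose g z : R := (all (fun i => m <= absz (z 0%R i))%N (enum 'I_d))%:R.
have g01 z : 0 <= g z <= 1 by rewrite /g; case: all; rewrite ?lexx ler01.
have M2 : 0 < M%:R ^+ 2 :> R.
  by apply: lt_le_trans tM; rewrite !mulr_gt0 ?exprn_gt0 // ltr0n.
set c := 2 ^+ d.-1 * (m%:R ^+ 2 / (2 * t)).
have c0 : 0 <= c by rewrite /c !mulr_ge0 ?exprn_ge0 ?invr_ge0 ?mulr_ge0.
have two_d : 2 ^+ d = 2 * 2 ^+ d.-1 :> R by rewrite -exprS prednK.
have key y : versine_prod th y <= 2 ^+ d * (\sum_(z <- box d M) g z * \1_[set z] y) +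
   1 * (2 ^+ d / M%:R ^+ 2 * norm_sq R y + c * 1).
  have vle : versine_prod th y <= 2 ^+ d.
    have := versine_prod_le th y (Ordinal d_gt0) => /le_trans; apply.
    rewrite two_d mulrC ler_wpM2r ?exprn_ge0 //.
    by have := cos_geN1 (th * (y 0 (Ordinal d_gt0))%:~R); lra.
  have n0 : 0 <= 2 ^+ d / M%:R ^+ 2 * norm_sq R y.
    by rewrite mulr_ge0 ?norm_sq_ge0 // divr_ge0 ?exprn_ge0.
  rewrite sum_indic ?box_uniq // mem_box mul1r mulr1.
  case: leqP => yM; last first.
    rewrite mulr0 add0r; apply: le_trans vle _; rewrite -[leLHS]addr0; apply: lerD => //.
    rewrite mulrAC ler_pdivlMr // ler_wpM2l ?exprn_ge0 //.
    apply: le_trans (norm_sq_ge_sup y).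
    by rewrite lerXn2r ?nnegrE // ler_nat ltnW.
  rewrite /g; case: (boolP (all _ _)) => [_|/allPn[i _ yi]].
    by rewrite mulr1; apply: le_trans vle _; rewrite lerDl addr_ge0.
  rewrite mulr0 add0r -[leLHS]add0r; apply: lerD => //.
  apply: le_trans (versine_prod_le th y i) _; rewrite ler_wpM2l ?exprn_ge0 //.
  apply: le_trans (versine_le _ _) _; rewrite cth opprB addrC subrK.
  rewrite ler_wpM2r ?invr_ge0 ?mulr_ge0 //.
  rewrite -(real_normK (num_real (y 0 i)%:~R)) -intr_norm -natr_absz.
  by rewrite lerXn2r ?nnegrE // ler_nat ltnW // ltnNge.
have main : (1 - expR (- (t * (2 - 2 * cos th)))) ^+ d <=
    2 ^+ d * (\sum_(z <- box d M) g z * heat_kernel t z) +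
    1 * (2 ^+ d / M%:R ^+ 2 * (2 * d%:R * t) + c * 1).
  rewrite -(ler_pM2l (expR_gt0 (4 * d%:R * t))).
  have s0 : 0 <= 4 * d%:R * t by rewrite !mulr_ge0.
  apply: (@exp_series_le _ _ _ (fun k => 2 ^+ d * (\sum_(z <- box d M) g z * walk R k z) +
    1 * (2 ^+ d / M%:R ^+ 2 * (k%:R / 2) + c * 1)) _ _ s0 _ (@versine_prod_exp_cvg th t)).
    move=> k; apply: (le_trans (iter_lazy_le k key 0)).
    rewrite iter_lazy_lin lerD ?sum_walk // iter_lazy_lin iter_lazy_norm_sq // iter_lazy_cst //.
    by rewrite /norm_sq big1 ?add0r // => i _; rewrite mxE expr0n.
  rewrite mulrDr [X in X + _]mulrCA [X in _ + X]mulrCA mulrDr [X in _ + _ * (X + _)]mulrCA.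
  rewrite [X in _ + _ * (_ + X)]mulrCA.
  apply: exp_series_lin; first exact: walk_exp_sum_cvg.
  apply: exp_series_lin; last exact: exp_series_cst.
  rewrite (_ : expR _ * _ = 4 * d%:R * t * expR (4 * d%:R * t) * 2^-1); last by field.
  rewrite (_ : series _ = (fun n => series (fun k => exp_coeff (4 * d%:R * t) k * k%:R) n * 2^-1)).
    by apply: cvgMr_tmp; exact: exp_series_id.
  by apply/funext => n; rewrite /series /= mulr_suml; apply: eq_bigr => k _; rewrite mulrA.
have e1 : expR (-1) <= 2^-1 :> R.
  rewrite expRN lef_pV2 ?posrE ?expR_gt0 //.
  by apply: le_trans (expR_ge1Dx 1); lra.
have tmu : t * (2 - 2 * cos th) = 1 by rewrite cth; field; lra.
have S_le : \sum_(z <- box d M) g z * heat_kernel t z <= (2 * M).+1%:R ^+ d * heat_kernel t x.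
  rewrite -natrX -size_box mulr_natl -iter_addr_0 -count_predT -big_const_seq.
  apply: ler_sum => z _.
  rewrite /g; case: allP => [hz|_]; last by rewrite mul0r heat_kernel_ge0.
  rewrite mul1r; apply: heat_kernel_decreasing => // i.
  have := hz i; rewrite mem_enum => /(_ isT) mi.
  by rewrite -!abszE lez_nat (leq_trans (leq_trans (le_sup_norm x i) xm) mi).
have hhalf : (2 ^+ d)^-1 <= (1 - expR (-1)) ^+ d :> R.
  by rewrite -exprVn lerXn2r ?nnegrE //; lra.
rewrite tmu in main.
move: hhalf main; set S := \sum_(z <- _) _ in S_le *; set H := _ * heat_kernel t x in S_le *.
have fd : 4 ^+ d = (2 ^+ d) ^+ 2 :> R by rewrite -exprM mulnC exprM; congr (_ ^+ _); ring.
rewrite -mulrA -/H; set a := 2 ^+ d in two_d fd *.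
have a0 : 0 < a by rewrite /a exprn_gt0.
(* Each of the two errors takes at most a quarter of [2 ^ (- d)]. *)
have h1 : a / M%:R ^+ 2 * (2 * d%:R * t) <= (4 * a)^-1.
  rewrite mulrAC ler_pdivrMr // ler_pdivlMl ?mulr_gt0 //.
  by apply: le_trans tM; rewrite fd; rewrite le_eqVlt; apply/orP; left; apply/eqP; ring.
have h2 : c <= (4 * a)^-1.
  rewrite /c (_ : 2 ^+ d.-1 = a / 2); last by rewrite two_d mulrC mulKf.
  rewrite mulrA ler_pdivrMr; last by lra.
  rewrite ler_pdivlMl ?mulr_gt0 //.
  apply: le_trans (_ : 2 * (4 ^+ d * m%:R ^+ 2) <= _); last by lra.
  by rewrite fd; rewrite le_eqVlt; apply/orP; left; apply/eqP; field.
rewrite !mul1r mulr1 => h3 h4.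
have h5 : (2 * a)^-1 <= a * H.
  apply: le_trans (_ : a * S <= _); last by rewrite ler_pM2l.
  have : (2 * a)^-1 + (4 * a)^-1 + (4 * a)^-1 = a^-1 by field; lra.
  by lra.
have a2 : 0 < 2 * a by rewrite mulr_gt0.
move: h5; rewrite -[X in X <= _]mulr1 ler_pdivrMl //.
by rewrite fd expr2 !mulrA.
Qed.

End LowerBound.

(** * Integrals against a power of time *)

Section SubordinationIntegral.
Variable R : realType.
Notation mu := (@lebesgue_measure R).
Notation half_line := (`]0, +oo[%classic : set R).

(** The function is dominated by the sum of the steps of heights [v n] and [v' n]
    on the intervals from 0 to [c n] and [c' n]; these overlap, which does no
    harm to an upper bound. *)
Lemma integral_le_steps (f : R -> R) (c c' v v' w : R^nat) (W : R) :
  measurable_fun half_line f -> (forall t, 0 < t -> 0 <= f t) ->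
  (forall n, 0 <= c n /\ 0 <= c' n) -> (forall n, 0 <= v n /\ 0 <= v' n) ->
  (forall t, 0 < t -> exists n, (t <= c n /\ f t <= v n) \/ (t <= c' n /\ f t <= v' n)) ->
  (forall n, v n * c n + v' n * c' n <= w n) ->
  series w @ \oo --> W ->
  (\int[mu]_(t in half_line) (f t)%:E <= W%:E)%E.
Proof.
move=> mf f0 c0 v0 cover vc wW.
pose step b (a : R) (t : R) : \bar R := (a%:E * (\1_(`]0, b]%classic) t)%:E)%E.
have step0 b a t : 0 <= a -> (0 <= step b a t)%E.
  by move=> a0; rewrite /step -EFinM lee_fin mulr_ge0 // indicE.
have mstep b a : measurable_fun half_line (step b a).
  by apply: measurable_funeM; apply/measurable_EFinP; exact: measurable_indic.
pose h n t := (step (c n) (v n) t + step (c' n) (v' n) t)%E.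
have h0 n t : (0 <= h n t)%E.
  by rewrite adde_ge0 // step0 //; case: (v0 n).
have mh n : measurable_fun half_line (h n) by apply: emeasurable_funD.
have istep b a : 0 <= b -> 0 <= a -> (\int[mu]_(t in half_line) step b a t = (a * b)%:E)%E.
  move=> b0 a0; rewrite /step ge0_integralZl //=; last first.
    by apply/measurable_EFinP; exact: measurable_indic.
  rewrite integral_indic //= setIidl; last first.
    by move=> t /=; rewrite !in_itv /= => /andP[->].
  rewrite lebesgue_measure_itv /= lte_fin; case: ltP => b0'.
    by rewrite sube0.
  by rewrite mule0 (_ : b = 0) ?mulr0 //; apply/eqP; rewrite eq_le b0 b0'.
apply: (@le_trans _ _ (\int[mu]_(t in half_line) \sum_(n <oo) h n t)%E).
  apply: ge0_le_integral => //=.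
  - by move=> t; rewrite in_itv /= andbT => t0; rewrite lee_fin f0.
  - exact/measurable_EFinP.
  - rewrite (_ : (fun x => _) = (fun x => \sum_(n <oo | n \in xpredT) h n x)%E) //.
    by apply: ge0_emeasurable_sum => // k _; exact: mh.
  - move=> t; rewrite in_itv /= andbT => t0.
    have [n ctn] := cover t t0.
    apply: (@le_trans _ _ (h n t)).
      rewrite /h; case: ctn => [[tc fv]|[tc fv]].
      + apply: (@le_trans _ _ (step (c n) (v n) t)); last by rewrite leeDl // step0 //; case: (v0 n).
        by rewrite /step indicE mem_set /= ?in_itv /= ?t0 // mule1 lee_fin.
      + apply: (@le_trans _ _ (step (c' n) (v' n) t)); last by rewrite leeDr // step0 //; case: (v0 n).
        by rewrite /step indicE mem_set /= ?in_itv /= ?t0 // mule1 lee_fin.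
    apply: le_trans (@nneseries_lim_ge _ (h ^~ t) xpredT 0%N n.+1 _) => //.
    by rewrite big_nat_recr //= leeDr // sume_ge0.
rewrite integral_nneseries //.
apply: lime_le.
  by apply: is_cvg_ereal_nneg_natsum_cond => n _ _; apply: integral_ge0.
apply: nearW => N.
apply: (@le_trans _ _ (series w N)%:E).
  rewrite /series /= -sumEFin; apply: lee_sum => n _.
  have [vn0 vn0'] := v0 n; rewrite ge0_integralD //; try exact: mstep;
    try by move=> t _; exact: step0.
  by case: (c0 n) (v0 n) => ? ? [? ?]; rewrite !istep // -EFinD lee_fin.
rewrite lee_fin.
have w0 n : 0 <= w n.
  by apply: le_trans (vc n); case: (c0 n) (v0 n) => ? ? [? ?]; rewrite addr_ge0 ?mulr_ge0.
have := @nondecreasing_cvgn_le R (series w) => H.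
rewrite -(cvg_lim (@Rhausdorff R) wW); apply: H; last by apply/cvg_ex; exists W.
by apply/nondecreasing_seqP => n; rewrite /series /= big_nat_recr //= lerDl.
Qed.

Lemma dyadic_bracket (x : R) : 1 <= x -> exists n : nat, 2 ^+ n <= x < 2 ^+ n.+1.
Proof.
move=> x1; have [N xN] : exists N : nat, x < 2 ^+ N.
  exists (Num.truncn x).+1; apply: lt_trans (truncnS_gt x) _.
  by rewrite -natrX ltr_nat ltn_expl.
have exP : exists N : nat, x < 2 ^+ N by exists N.
case: (ex_minnP exP) => -[|n] xn nmin; first by move: xn; rewrite expr0 ltNge x1.
exists n; rewrite xn andbT leNgt; apply/negP => /nmin.
by rewrite ltnn.
Qed.

Lemma powR_exprn (a p : R) (n : nat) : 0 <= a -> (a ^+ n) `^ p = (a `^ p) ^+ n.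
Proof. by move=> a0; rewrite -powR_mulrn // powRAC powR_mulrn ?powR_ge0. Qed.

Lemma powRD_gt0 (x r p : R) : 0 < x -> x `^ (r + p) = x `^ r * x `^ p.
Proof. by move=> x0; rewrite powRD // (gt_eqF x0) implybT. Qed.

Lemma two_powR_lt1 (p : R) : p < 0 -> `|2 `^ p : R| < 1.
Proof.
move=> p0; rewrite ger0_norm ?powR_ge0 // -[p]opprK powRN invf_lt1 ?powR_gt0 //.
suff : 1 `^ (- p) < 2 `^ (- p) :> R by rewrite powR1.
by apply: gt0_ltr_powR; rewrite ?nnegrE ?oppr_gt0 // ltr1n.
Qed.

Lemma measurable_subordination (s : R) (f : R -> R) : measurable_fun half_line f ->
  measurable_fun half_line (fun t => f t / t `^ (1 + s)).
Proof.
move=> mf; rewrite (_ : (fun t => _) = (fun t => f t * t `^ (- (1 + s)))); last first.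
  by apply/funext => t; rewrite powRN.
by apply: measurable_funM => //; apply: measurable_funTS; exact: measurable_powR.
Qed.

(** In the variable [a t] the integrand is [a ^ (1 + s)] times [(a t) ^ (- s)] below 1
    and at most [a ^ (1 + s)] times [(a t) ^ (- 1 - s)] above 1.  Cut at the powers
    of 2, the two parts are bounded by geometric series of ratios [2 ^ (s - 1)]
    and [2 ^ (- s)]. *)
Lemma subordination_integral_le (s : R) : 0 < s < 1 -> exists2 C : R, 0 < C &
  forall a, 0 < a ->
  (\int[mu]_(t in half_line) (Num.min 1 (a * t) / t `^ (1 + s))%:E <= (C * a `^ s)%:E)%E.
Proof.
move=> /andP[s0 s1].
pose q1 : R := 2 `^ (- s); pose q2 : R := 2 `^ (s - 1).
have q1lt : `|q1| < 1 by apply: two_powR_lt1; rewrite oppr_lt0.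
have q2lt : `|q2| < 1 by apply: two_powR_lt1; rewrite subr_lt0.
exists (2 * ((1 - q1)^-1 + (1 - q2)^-1)).
  have h q : `|q| < 1 -> 0 < (1 - q)^-1 :> R.
    by move=> q1'; rewrite invr_gt0 subr_gt0 (le_lt_trans (ler_norm _) q1').
  by rewrite mulr_gt0 // addr_gt0 // h.
move=> a a0.
have two_gt0 n : 0 < 2 ^+ n :> R by rewrite exprn_gt0.
have as0 : 0 < a `^ s by rewrite powR_gt0.
have a1s : a `^ (1 + s) = a * a `^ s.
  by rewrite powRD_gt0 // powRr1 // ltW.
apply: (@integral_le_steps _ (fun n => 2 ^+ n.+1 / a) (fun n => (2 ^+ n)^-1 / a)
   (fun n => a `^ (1 + s) / (2 ^+ n) `^ (1 + s)) (fun n => a `^ (1 + s) * (2 ^+ n.+1) `^ s)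
   (fun n => 2 * a `^ s * (q1 ^+ n + q2 ^+ n))).
- apply: measurable_subordination; apply: measurable_minr => //.
- move=> t t0; rewrite divr_ge0 ?powR_ge0 // le_min ler01 mulr_ge0 //; exact: ltW.
- by move=> n; split; apply: divr_ge0; rewrite ?invr_ge0 // ltW.
- by move=> n; split; [apply: divr_ge0|apply: mulr_ge0]; exact: powR_ge0.
- move=> t t0; have at0 : 0 < a * t by rewrite mulr_gt0.
  have [at1|at1] := leP 1 (a * t).
    have [n /andP[n1 n2]] := dyadic_bracket at1; exists n; left; split.
      by rewrite ler_pdivlMr // mulrC ltW.
    rewrite ler_pdivrMr ?powR_gt0 // mulrAC ler_pdivlMr ?powR_gt0 ?two_gt0 //.
    rewrite mul1r -powRM ?(ltW a0) ?(ltW t0) //.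
    by apply: ge0_ler_powR => //; rewrite ?nnegrE ?addr_ge0 // ltW.
  have at1' : 1 <= (a * t)^-1 by rewrite invf_ge1 // ltW.
  have [n /andP[n1 n2]] := dyadic_bracket at1'; exists n; right; split.
    rewrite ler_pdivlMr // mulrC -[leLHS]invrK lef_pV2 // posrE ?invr_gt0 //.
  rewrite ler_pdivrMr ?powR_gt0 // a1s powRD_gt0 // powRr1; last exact: ltW.
  rewrite (_ : a * _ * _ * _ = a * t * ((2 ^+ n.+1) `^ s * (a `^ s * t `^ s))); last by ring.
  rewrite -[leLHS]mulr1 ler_pM2l // -powRM ?(ltW a0) ?(ltW t0) // -powRM ?(ltW at0) ?(ltW (two_gt0 _)) //.
  suff : 1 `^ s <= (2 ^+ n.+1 * (a * t)) `^ s by rewrite powR1.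
  apply: ge0_ler_powR => //; rewrite ?nnegrE ?mulr_ge0 ?ltW //.
  by rewrite -ltr_pdivrMr // mul1r.
- move=> n; rewrite a1s mulrDr.
  have p0 := two_gt0 n; have h1 := powR_gt0 s p0.
  apply: lerD; rewrite -powR_exprn //.
    rewrite powRN powRD_gt0 // powRr1 ?(ltW p0) //.
    rewrite exprS le_eqVlt; apply/orP; left; apply/eqP.
    by field; rewrite !gt_eqF.
  rewrite powRD_gt0 // powRN powRr1 ?(ltW p0) //.
  rewrite exprS powRM ?(ltW p0) //.
  rewrite (_ : a * _ * _ * _ = 2 `^ s * (a `^ s * ((2 ^+ n) `^ s / 2 ^+ n))); last first.
    by field; rewrite !gt_eqF.
  rewrite -[leRHS]mulrA ler_wpM2r ?mulr_ge0 ?invr_ge0 ?powR_ge0 // ?(ltW p0) //.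
  by apply: ler1_powR; rewrite ?ler1n // ltW.
rewrite (_ : 2 * (_ + _) * _ = 2 * a `^ s * ((1 - q1)^-1 + (1 - q2)^-1)); last by ring.
rewrite (_ : series _ = (fun N => 2 * a `^ s *
   (series (geometric 1 q1) N + series (geometric 1 q2) N))).
  apply: cvgMl_tmp; rewrite -[(1 - q1)^-1]mul1r -[(1 - q2)^-1]mul1r.
  by apply: cvgD; apply: cvg_geometric_series.
apply/funext => N; rewrite /series /= -big_split mulr_sumr; apply: eq_bigr => n _ /=.
by rewrite !mul1r.
Qed.

End SubordinationIntegral.

(** * Two-sided bounds for the fractional weight *)

Section FractionalWeight.
Variables (R : realType) (d : nat) (sigma : R).
Hypothesis d_gt0 : (0 < d)%N.
Hypothesis sigma01 : 0 < sigma < 1.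
Notation mu := (@lebesgue_measure R).
Notation half_line := (`]0, +oo[%classic : set R).
Implicit Types (x y z : lattice d) (t : R).

Let sigma_gt0 : 0 < sigma. Proof. by case/andP: sigma01. Qed.

Lemma half_lineP t : half_line t -> 0 < t.
Proof. by rewrite /= in_itv /= andbT. Qed.

Lemma measurable_heat_kernel z : measurable_fun half_line (fun t => heat_kernel t z).
Proof.
pose h (N : nat) t := expR (- (4 * d%:R * t)) *
  \sum_(0 <= k < N) ((4 * d%:R * t) ^+ k * (k`!%:R^-1 * walk R k z)).
have mlin : measurable_fun half_line (fun t => 4 * d%:R * t).
  by apply: measurable_funTS; exact: mulrl_measurable.
apply: (@measurable_fun_cvg _ _ _ _ h).
  move=> N; apply: measurable_funM.
    by apply: measurableT_comp => //; exact: measurableT_comp.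
  apply: measurable_sum => k; apply: measurable_funM => //.
  exact: measurable_funX.
move=> t /half_lineP t0; rewrite /heat_kernel; apply: cvgMl_tmp.
rewrite (_ : (fun N => _) = series (fun k => exp_coeff (4 * d%:R * t) k * walk R k z)).
  apply: (@bounded_exp_cvg _ _ _ 1); first by rewrite !mulr_ge0 // ltW.
  by move=> k; rewrite ger0_norm ?walk_le1 ?walk_ge0.
by apply/funext => N; rewrite /series /=; apply: eq_bigr => k _; rewrite mulrA.
Qed.

Definition subordinated z : \bar R :=
  (\int[mu]_(t in half_line) (heat_kernel t z / t `^ (1 + sigma))%:E)%E.

Lemma measurable_subordinated z :
  measurable_fun half_line (fun t => (heat_kernel t z / t `^ (1 + sigma))%:E).
Proof.
apply/measurable_EFinP; apply: measurable_subordination; exact: measurable_heat_kernel.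
Qed.

Lemma subordinated_ge0 z : (0 <= subordinated z)%E.
Proof.
apply: integral_ge0 => t /half_lineP t0.
by rewrite lee_fin divr_ge0 ?powR_ge0 // heat_kernel_ge0 // ltW.
Qed.

Lemma sum_subordinated_le (F : seq (lattice d)) (g : lattice d -> R) (h : R -> R) :
  (forall z, 0 <= g z) ->
  measurable_fun half_line h ->
  (forall t, 0 < t -> \sum_(z <- F) g z * heat_kernel t z <= h t) ->
  (\sum_(z <- F) (g z)%:E * subordinated z <=
     \int[mu]_(t in half_line) (h t / t `^ (1 + sigma))%:E)%E.
Proof.
move=> g0 mh gh.
have hk0 t z : half_line t -> 0 <= heat_kernel t z.
  by move=> /half_lineP t0; apply: heat_kernel_ge0 => //; exact: ltW.
have int0 t z : half_line t -> (0 <= (heat_kernel t z / t `^ (1 + sigma))%:E)%E.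
  by move=> t0; rewrite lee_fin divr_ge0 ?powR_ge0 // hk0.
have -> : (\sum_(z <- F) (g z)%:E * subordinated z =
    \int[mu]_(t in half_line) \sum_(z <- F) ((g z)%:E * (heat_kernel t z / t `^ (1 + sigma))%:E))%E.
  rewrite ge0_integral_sum //.
  - apply: eq_bigr => z _; rewrite ge0_integralZl //.
    + exact: measurable_subordinated.
    + by move=> t; exact: int0.
    + by rewrite lee_fin.
  - by move=> z; apply: measurable_funeM; exact: measurable_subordinated.
  - by move=> z t t0; rewrite mule_ge0 ?lee_fin // -lee_fin int0.
apply: ge0_le_integral => //.
- by move=> t t0; apply: sume_ge0 => z _; rewrite mule_ge0 ?lee_fin // -lee_fin int0.
- by apply: emeasurable_sum => z; apply: measurable_funeM; exact: measurable_subordinated.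
- by apply/measurable_EFinP; exact: measurable_subordination.
move=> t t0; under eq_bigr do rewrite -EFinM.
rewrite sumEFin lee_fin; under eq_bigr do rewrite mulrA.
rewrite -mulr_suml ler_wpM2r ?invr_ge0 ?powR_ge0 //.
by apply: gh; exact: half_lineP.
Qed.

Definition trunc_dist (n : nat) z : R := Num.min 1 ((sup_norm z)%:R / n%:R).

Lemma trunc_dist_itv n z : 0 <= trunc_dist n z <= 1.
Proof. by rewrite /trunc_dist ge_min lexx /= le_min ler01 divr_ge0. Qed.

Lemma trunc_dist_sq_itv n z : 0 <= trunc_dist n z ^+ 2 <= 1.
Proof.
have /andP[h0 h1] := trunc_dist_itv n z.
by rewrite sqr_ge0 expr_le1.
Qed.

Lemma trunc_dist_sq_le n z : trunc_dist n z ^+ 2 <= n%:R ^- 2 * norm_sq R z.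
Proof.
have /andP[h0 h1] := trunc_dist_itv n z.
apply: (@le_trans _ _ (((sup_norm z)%:R / n%:R) ^+ 2)).
  by rewrite lerXn2r ?nnegrE ?divr_ge0 // /trunc_dist ge_min lexx orbT.
rewrite exprMn exprVn mulrC ler_wpM2l ?invr_ge0 ?exprn_ge0 //.
exact: norm_sq_ge_sup.
Qed.

(** At time [t] the squared truncated distance has mean at most
    [min(1, 2 d t / n ^ 2)] under the heat kernel. *)
Lemma sum_subordinated_trunc : exists2 C : R, 0 < C &
  forall (n : nat) (F : seq (lattice d)), (0 < n)%N -> uniq F ->
  (\sum_(z <- F) (trunc_dist n z ^+ 2)%:E * subordinated z <=
   (C * n%:R `^ (- (2 * sigma)))%:E)%E.
Proof.
have [C C0 hC] := subordination_integral_le sigma01.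
have d0 : 0 < d%:R :> R by rewrite ltr0n.
have d1 : 1 <= d%:R :> R by rewrite ler1n.
exists (2 * d%:R * C); first by rewrite !mulr_gt0.
move=> n F n0 uF; pose a : R := n%:R ^- 2.
have n0' : 0 < n%:R :> R by rewrite ltr0n.
have a0 : 0 < a by rewrite invr_gt0 exprn_gt0.
have mmin : measurable_fun half_line (fun t => Num.min 1 (a * t)).
  by apply: measurable_minr.
have min0 t : 0 < t -> 0 <= Num.min 1 (a * t).
  by move=> t0; rewrite le_min ler01 mulr_ge0 // ltW.
apply: le_trans (sum_subordinated_le (h := fun t => 2 * d%:R * Num.min 1 (a * t)) _ _ _) _.
- by move=> z; case/andP: (trunc_dist_sq_itv n z).
- exact: measurable_funM.
- move=> t t0.
  have h1 := heat_kernel_mass d_gt0 (ltW t0) uF (trunc_dist_sq_itv n).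
  have h2 := heat_kernel_second_moment d_gt0 (ltW t0) uF (ltW a0) (trunc_dist_sq_le n).
  have [at1|at1] := leP 1 (a * t).
    by rewrite mulr1; apply: le_trans h1 _; lra.
  by apply: le_trans h2 _; rewrite mulrA mulrAC.
rewrite (_ : (\int[mu]_(t in half_line) _ =
   (2 * d%:R)%:E * \int[mu]_(t in half_line) (Num.min 1 (a * t) / t `^ (1 + sigma))%:E)%E); last first.
  rewrite -ge0_integralZl //.
  - by apply: eq_integral => t _; rewrite -EFinM mulrA.
  - by apply/measurable_EFinP; exact: measurable_subordination.
  - by move=> t /half_lineP t0; rewrite lee_fin divr_ge0 ?powR_ge0 ?min0.
rewrite -mulrA [X in (_ <= X)%E]EFinM; apply: lee_pmul; rewrite ?lee_fin ?mulr_ge0 //;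
  first by apply: integral_ge0 => t /half_lineP t0; rewrite lee_fin divr_ge0 ?powR_ge0 ?min0.
have -> : n%:R `^ (- (2 * sigma)) = a `^ sigma :> R.
  by rewrite /a -powR_invn ?ltW // -powRrM mulNr.
exact: hC.
Qed.

Lemma sup_norm_eq0 z : (sup_norm z == 0%N) = (z == 0).
Proof.
apply/idP/eqP => [|->].
  rewrite -leqn0 => /sup_norm_leP z0; apply/rowP => i; rewrite mxE.
  by apply/eqP; rewrite -absz_eq0 -leqn0.
by rewrite -leqn0; apply/sup_norm_leP => i; rewrite mxE.
Qed.

Lemma sup_norm_gt0 z : (0 < sup_norm z)%N = (z != 0).
Proof. by rewrite lt0n sup_norm_eq0. Qed.

Lemma trunc_dist1 z : z != 0 -> trunc_dist 1 z = 1.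
Proof.
rewrite -sup_norm_gt0 => z0; rewrite /trunc_dist divr1; apply/min_idPl.
by rewrite ler1n.
Qed.

Lemma subordinated_fin z : z != 0 -> subordinated z \is a fin_num.
Proof.
move=> z0; rewrite ge0_fin_numE ?subordinated_ge0 //.
have [C _ hC] := sum_subordinated_trunc.
have := hC 1%N [:: z] isT isT.
rewrite big_cons big_nil adde0 trunc_dist1 // expr1n mul1e => /le_lt_trans; apply.
exact: ltry.
Qed.

(** The integral defining Gamma at [1 - sigma] must be shown finite as well as
    positive, since the real value of an infinite integral is 0.  It is dominated
    by the subordination integral, as [t e^{- t} <= min(1, t)]. *)
Lemma Gamma_neg_gt0 : 0 < `|Gamma (- sigma)|^-1.
Proof.
rewrite invr_gt0 normr_gt0 /Gamma oppr_gt0 ltNge (ltW sigma_gt0) /= opprK.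
have -> : Num.truncn sigma = 0%N.
  by apply: Num.Theory.truncn_def; have := sigma01; lra.
rewrite big_ord_recl big_ord0 mulr1 addr0.
rewrite mulf_neq0 // ?invr_eq0 ?oppr_eq0 ?gt_eqF //.
rewrite addrC /Euler_Gamma /Rintegral.
set I := (\int[_]_(_ in _) _)%E.
pose f t : R := t `^ (1 - sigma - 1) * expR (- t).
have f_gt0 t : 0 < t -> 0 < f t by move=> t0; rewrite mulr_gt0 ?powR_gt0 ?expR_gt0.
have mf : measurable_fun half_line f.
  apply: measurable_funM; first by apply: measurable_funTS; exact: measurable_powR.
  by apply: measurable_funTS; apply: measurableT_comp.
have I_lty : (I < +oo)%E.
  have [C C0 hC] := subordination_integral_le sigma01.
  apply: le_lt_trans (ltry (C * 1 `^ sigma)).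
  apply: le_trans (hC 1 ltr01); apply: ge0_le_integral => //.
  - by move=> t /half_lineP t0; rewrite lee_fin ltW // f_gt0.
  - exact/measurable_EFinP.
  - apply/measurable_EFinP; apply: measurable_subordination.
    by apply: measurable_minr => //; apply: measurable_funTS; exact: mulrl_measurable.
  move=> t /half_lineP t0; rewrite lee_fin ler_pdivlMr ?powR_gt0 // mul1r /f.
  rewrite mulrAC -powRD_gt0 // (_ : 1 - sigma - 1 + (1 + sigma) = 1); last by ring.
  rewrite powRr1 ?(ltW t0) // expRN le_min.
  have e0 := expR_gt0 t; have e1 := expR_ge1Dx t.
  rewrite ler_pdivrMr // mul1r; apply/andP; split; first by lra.
  by rewrite ler_pdivrMr // -[leLHS]mulr1 ler_pM2l //; lra.
have I_gt0 : (0 < I)%E.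
  apply: (@lt_le_trans _ _ (\int[mu]_(t in `[1%R, 2%R]) (2 `^ (- sigma) * expR (- 2))%:E)%E).
    rewrite integral_cst //= lebesgue_measure_itv /= lte_fin ltr1n -EFinB -EFinM lte_fin.
    by rewrite !mulr_gt0 ?powR_gt0 ?expR_gt0 // subr_gt0 ltr1n.
  apply: (@le_trans _ _ (\int[mu]_(t in `[1%R, 2%R]) (f t)%:E)%E).
    apply: ge0_le_integral => //.
    + apply/measurable_EFinP; apply: measurable_funS mf => //.
      by move=> t /=; rewrite !in_itv /= andbT => /andP[t1 _]; lra.
    move=> t /=; rewrite in_itv /= => /andP[t1 t2]; rewrite lee_fin /f.
    rewrite (_ : 1 - sigma - 1 = - sigma); last by ring.
    apply: ler_pM; rewrite ?powR_ge0 ?expR_ge0 //.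
      rewrite !powRN lef_pV2 ?posrE ?powR_gt0 //; last by lra.
      by apply: ge0_ler_powR; rewrite ?nnegrE; have := sigma_gt0; lra.
    by rewrite ler_expR; lra.
  apply: ge0_subset_integral => //.
  - exact/measurable_EFinP.
  - by move=> t /half_lineP t0; rewrite lee_fin ltW // f_gt0.
  by move=> t /=; rewrite !in_itv /= andbT => /andP[t1 _]; lra.
by rewrite fine_gt0 // I_gt0.
Qed.

Definition translation_weight z : R :=
  if z == 0 then 0 else `|Gamma (- sigma)|^-1 * fine (subordinated z).

Lemma frac_weightE x y : frac_weight sigma x y = translation_weight (x - y).
Proof.
rewrite /frac_weight /translation_weight subr_eq0; case: eqP => // _; congr (_ * _).
rewrite /Rintegral; congr fine; apply: eq_integral => t.
by rewrite inE => /half_lineP t0; rewrite heat_indic // ltW.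
Qed.

Lemma translation_weight_ge0 z : 0 <= translation_weight z.
Proof.
rewrite /translation_weight; case: eqP => // _.
by rewrite mulr_ge0 // fine_ge0 // subordinated_ge0.
Qed.

Lemma translation_weight0 : translation_weight 0 = 0.
Proof. by rewrite /translation_weight eqxx. Qed.

Lemma translation_weightN z : translation_weight (- z) = translation_weight z.
Proof.
rewrite /translation_weight oppr_eq0; case: eqP => // _; congr (_ * fine _).
apply: eq_integral => t; rewrite inE => /half_lineP t0.
by rewrite coord_decreasing_even //; apply: heat_kernel_decreasing => //; exact: ltW.
Qed.

Lemma sum_translation_weight_trunc : exists2 C : R, 0 < C &
  forall (n : nat) (F : seq (lattice d)), (0 < n)%N -> uniq F ->
  \sum_(z <- F) translation_weight z * trunc_dist n z ^+ 2 <= C * n%:R `^ (- (2 * sigma)).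
Proof.
have [C C0 hC] := sum_subordinated_trunc.
exists (`|Gamma (- sigma)|^-1 * C); first by rewrite mulr_gt0 // Gamma_neg_gt0.
move=> n F n0 uF.
have := hC n [seq z <- F | z != 0] n0 (filter_uniq _ uF).
rewrite big_filter (eq_bigr (fun z => (trunc_dist n z ^+ 2 * fine (subordinated z))%:E)) => [|z z0].
  rewrite sumEFin lee_fin => h.
  rewrite -mulrA; apply: le_trans (ler_wpM2l (ltW Gamma_neg_gt0) h).
  rewrite mulr_sumr [leLHS](bigID (fun z => z == 0)) /= big1 ?add0r => [|z /eqP->].
    rewrite le_eqVlt; apply/orP; left; apply/eqP; apply: eq_bigr => z z0.
    by rewrite /translation_weight (negbTE z0); ring.
  by rewrite translation_weight0 mul0r.
by rewrite [RHS]EFinM fineK // subordinated_fin.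
Qed.

(** Times between [T] and [2 T], for [T] a suitable multiple of [|z| ^ 2], already
    contribute the right order. *)
Lemma translation_weight_lower : exists2 c : R, 0 < c &
  forall z, z != 0 -> c <= translation_weight z * (sup_norm z)%:R `^ (2 * sigma + d%:R).
Proof.
have d0 : 0 < d%:R :> R by rewrite ltr0n.
have d1 : 1 <= d%:R :> R by rewrite ler1n.
(* [K * m] is the outer radius at which [heat_kernel_lower] applies up to time
   [2 T]. *)
have [K K0 K2] : exists2 K : nat, (0 < K)%N &
    16 * d%:R * (4 ^+ d) ^+ 2 <= K%:R ^+ 2 :> R.
  exists (4 * d * 4 ^ d)%N; first by rewrite !muln_gt0 /= d_gt0 expn_gt0.
  rewrite !natrM natrX [leRHS](_ : _ = 16 * (d%:R * d%:R) * (4 ^+ d) ^+ 2); last by ring.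
  by rewrite ler_wpM2r ?sqr_ge0 // ler_pM2l // -[leLHS]mulr1 ler_pM2l.
have K3 : 0 < (3 * K)%:R :> R by rewrite ltr0n muln_gt0 K0.
pose c1 : R := (2 * 4 ^+ d * (3 * K)%:R ^+ d)^-1.
have p4 : 0 < 4 ^+ d :> R by rewrite exprn_gt0.
have c1_gt0 : 0 < c1 by rewrite invr_gt0 !mulr_gt0 ?exprn_gt0.
pose G : R := `|Gamma (- sigma)|^-1.
have G0 : 0 < G := Gamma_neg_gt0.
exists (G * (c1 / (2 * 4 ^+ d) `^ (1 + sigma) * 4 ^+ d)).
  by rewrite !mulr_gt0 // ?invr_gt0 // powR_gt0 // mulr_gt0.
move=> z z0; rewrite /translation_weight (negbTE z0) -/G -[leRHS]mulrA ler_pM2l //.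
set m := sup_norm z.
have m0 : (0 < m)%N by rewrite sup_norm_gt0.
have m0' : 0 < m%:R :> R by rewrite ltr0n.
pose T : R := 4 ^+ d * m%:R ^+ 2.
have T0 : 0 < T by rewrite mulr_gt0 ?exprn_gt0.
have lower t : T <= t <= 2 * T ->
    c1 / m%:R ^+ d / (2 * T) `^ (1 + sigma) <= heat_kernel t z / t `^ (1 + sigma).
  move=> /andP[Tt tT].
  have t0 : 0 < t by exact: lt_le_trans Tt.
  apply: ler_pM.
  - by rewrite divr_ge0 ?exprn_ge0 // ltW.
  - by rewrite invr_ge0 powR_ge0.
  - have := @heat_kernel_lower R d d_gt0 t m (K * m) z m0 Tt.
    have hK : 8 * d%:R * 4 ^+ d * t <= (K * m)%:R ^+ 2.
      apply: (@le_trans _ _ (8 * d%:R * 4 ^+ d * (2 * T))).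
        by rewrite ler_pM2l // !mulr_gt0.
      rewrite /T natrM exprMn.
      rewrite (_ : 8 * _ * _ * _ = 16 * d%:R * (4 ^+ d) ^+ 2 * m%:R ^+ 2); last by ring.
      by rewrite ler_wpM2r ?sqr_ge0.
    move=> /(_ hK (leqnn _)) h.
    rewrite ler_pdivrMr ?exprn_gt0 // -[c1]mul1r ler_pdivrMr; last first.
      by rewrite !mulr_gt0 ?exprn_gt0.
    apply: le_trans h _.
    have h0 : 0 <= heat_kernel t z by rewrite heat_kernel_ge0 // ltW.
    rewrite (_ : 2 * _ * _ * _ = 2 * 4 ^+ d * heat_kernel t z * (2 * (K * m)).+1%:R ^+ d); last by ring.
    rewrite [leRHS](_ : _ = 2 * 4 ^+ d * heat_kernel t z * (m%:R ^+ d * (3 * K)%:R ^+ d)); last by ring.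
    apply: ler_wpM2l; first by apply: mulr_ge0 => //; apply: mulr_ge0 => //; exact: ltW.
    rewrite -exprMn lerXn2r ?nnegrE //.
    rewrite -natrM ler_nat.
    have : (0 < K * m)%N by rewrite muln_gt0 K0.
    rewrite (_ : (m * (3 * K) = 2 * (K * m) + K * m)%N); last first.
      by rewrite mulnCA [(m * K)%N]mulnC (mulnDl 2 1) mul1n.
    by move=> Km; rewrite -addn1 leq_add2l.
  - rewrite lef_pV2 ?posrE ?powR_gt0 ?mulr_gt0 //.
    by apply: ge0_ler_powR => //; rewrite ?nnegrE; have := sigma_gt0; lra.
have : ((c1 / m%:R ^+ d / (2 * T) `^ (1 + sigma) * T)%:E <= subordinated z)%E.
  apply: (@le_trans _ _ (\int[mu]_(t in `[T, (2 * T)%R]) (c1 / m%:R ^+ d / (2 * T) `^ (1 + sigma))%:E)%E).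
    rewrite integral_cst //= lebesgue_measure_itv /= lte_fin ifT; last by lra.
    by rewrite -EFinB -EFinM lee_fin (_ : 2 * T - T = T) //; ring.
  have sub : [set` `[T, (2 * T)%R]] `<=` half_line.
    by move=> t /=; rewrite !in_itv /= andbT => /andP[t1 _]; exact: lt_le_trans t1.
  apply: (@le_trans _ _ (\int[mu]_(t in `[T, (2 * T)%R]) (heat_kernel t z / t `^ (1 + sigma))%:E)%E).
    apply: ge0_le_integral => //.
    + move=> t _; rewrite lee_fin !mulr_ge0 ?invr_ge0 ?powR_ge0 ?exprn_ge0 //; exact: ltW.
    + by apply: measurable_funS (measurable_subordinated z).
  apply: ge0_subset_integral => //.
  - exact: measurable_subordinated.
  move=> t /half_lineP t0.
  by rewrite lee_fin divr_ge0 ?powR_ge0 // heat_kernel_ge0 // ltW.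
rewrite -[subordinated z]fineK ?subordinated_fin // lee_fin => h.
have := ler_wpM2r (powR_ge0 m%:R (2 * sigma + d%:R)) h; apply: le_trans.
rewrite le_eqVlt; apply/orP; left; apply/eqP.
have -> : m%:R `^ (2 * sigma + d%:R) = (m%:R ^+ 2) `^ sigma * m%:R ^+ d :> R.
  by rewrite powRD_gt0 // powRrM -!powR_mulrn // ltW.
have -> : (2 * T) `^ (1 + sigma) =
    (2 * 4 ^+ d) `^ (1 + sigma) * (m%:R ^+ 2 * (m%:R ^+ 2) `^ sigma).
  rewrite /T mulrA powRM; [|by rewrite ltW // mulr_gt0|by rewrite exprn_ge0].
  by rewrite [(m%:R ^+ 2) `^ (1 + sigma)]powRD_gt0 ?exprn_gt0 // powRr1 ?exprn_ge0.
rewrite /T.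
have m2s : 0 < (m%:R ^+ 2) `^ sigma :> R by rewrite powR_gt0 // exprn_gt0.
have q0 : 0 < (2 * 4 ^+ d) `^ (1 + sigma) :> R by rewrite powR_gt0 // mulr_gt0.
have md : 0 < m%:R ^+ d :> R by rewrite exprn_gt0.
by field; rewrite !gt_eqF.
Qed.

End FractionalWeight.

(** * Sums over the lattice as limits over boxes *)

Section LatticeSums.
Variables (R : realType) (d : nat).
Implicit Types (x y z : lattice d) (a h : lattice d -> R).

Lemma sum_subseq_le a (r s : seq (lattice d)) : (forall z, 0 <= a z) ->
  uniq r -> uniq s -> {subset r <= s} -> \sum_(z <- r) a z <= \sum_(z <- s) a z.
Proof.
move=> a0 ur us rs; rewrite [leRHS](bigID (mem r)) /=.
have -> : \sum_(z <- s | z \in r) a z = \sum_(z <- r) a z.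
  rewrite -big_filter; apply: perm_big; apply: uniq_perm; rewrite ?filter_uniq // => z.
  by rewrite mem_filter; case: (boolP (z \in r)) => //= /rs.
by rewrite lerDl sumr_ge0.
Qed.

Lemma box_sum_le a (m n : nat) : (forall z, 0 <= a z) -> (m <= n)%N ->
  \sum_(z <- box d m) a z <= \sum_(z <- box d n) a z.
Proof.
move=> a0 mn; apply: sum_subseq_le => // [||z]; rewrite ?box_uniq // !mem_box.
by move=> zm; exact: leq_trans mn.
Qed.

Lemma box_sum_supp h (m n : nat) : (m <= n)%N -> (forall z, (m < sup_norm z)%N -> h z = 0) ->
  \sum_(z <- box d n) h z = \sum_(z <- box d m) h z.
Proof.
move=> mn h0; rewrite [LHS](bigID (mem (box d m))) /= [X in _ + X]big1 ?addr0 => [|z].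
  rewrite -big_filter; apply: perm_big; apply: uniq_perm; rewrite ?filter_uniq ?box_uniq // => z.
  by rewrite mem_filter !mem_box; case: leqP => //= zm; rewrite (leq_trans zm mn).
by rewrite mem_box -ltnNge => /h0.
Qed.

Lemma finite_set_box (A : set (lattice d)) : finite_set A ->
  exists n, forall z, A z -> (sup_norm z <= n)%N.
Proof.
move=> fA; exists (\max_(z <- finmap.enum_fset (fset_set A)) sup_norm z)%N => z Az.
by rewrite (@leq_bigmax_seq _ (finmap.enum_fset (fset_set A)) xpredT) // in_fset_set // inE.
Qed.

Lemma box_sum_le_esum a n : (forall z, 0 <= a z) ->
  ((\sum_(z <- box d n) a z)%:E <= \esum_(z in [set: lattice d]) (a z)%:E)%E.
Proof.
move=> a0; apply: esum_ge; exists [set` box d n].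
  by split => //; exact: finite_seq.
by rewrite -fsbig_seq ?box_uniq // sumEFin.
Qed.

Lemma esum_lty a (C : R) : (forall z, 0 <= a z) ->
  (forall n, \sum_(z <- box d n) a z <= C) ->
  (\esum_(z in [set: lattice d]) (a z)%:E < +oo)%E.
Proof.
move=> a0 aC; apply: (@le_lt_trans _ _ C%:E); last exact: ltry.
apply: ge_ereal_sup => _ [A [fA _] <-].
have [n An] := finite_set_box fA.
rewrite fsbig_finite // sumEFin lee_fin; apply: le_trans (aC n).
apply: sum_subseq_le; rewrite ?box_uniq ?finmap.fset_uniq // => z.
by rewrite in_fset_set // inE mem_box => /An.
Qed.

Lemma box_sum_cvg a : (forall z, 0 <= a z) ->
  (\esum_(z in [set: lattice d]) (a z)%:E < +oo)%E ->
  (fun n => \sum_(z <- box d n) a z) @ \oo -->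
    fine (\esum_(z in [set: lattice d]) (a z)%:E).
Proof.
move=> a0 alty.
have afin : \esum_(z in [set: lattice d]) (a z)%:E \is a fin_num.
  by rewrite ge0_fin_numE // esum_ge0 // => z _; rewrite lee_fin.
apply/cvgrPdist_le => /= e e0.
have [_ [A [fA _] <-]] := ub_ereal_sup_adherent e0 afin.
have [N AN] := finite_set_box fA.
rewrite fsbig_finite // sumEFin -[X in (X - _)%E]fineK // -EFinB lte_fin => hA.
exists N => // n /= Nn.
have h1 : \sum_(z <- finmap.enum_fset (fset_set A)) a z <= \sum_(z <- box d n) a z.
  apply: sum_subseq_le; rewrite ?box_uniq ?finmap.fset_uniq // => z.
  by rewrite in_fset_set // inE mem_box => /AN /leq_trans; apply.
have := box_sum_le_esum n a0.
rewrite -[X in (_ <= X)%E]fineK // lee_fin => h2.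
by rewrite ger0_norm ?subr_ge0 //; move: hA; rewrite /esum; lra.
Qed.

Lemma lattice_sum_cvg h :
  (\esum_(z in [set: lattice d]) `|h z|%:E < +oo)%E ->
  (fun n => \sum_(z <- box d n) h z) @ \oo --> lattice_sum h.
Proof.
move=> hlty.
pose p z := Num.max (h z) 0; pose q z := Num.max (- h z) 0.
have p0 z : 0 <= p z by rewrite le_max lexx orbT.
have q0 z : 0 <= q z by rewrite le_max lexx orbT.
have plty : (\esum_(z in [set: lattice d]) (p z)%:E < +oo)%E.
  apply: le_lt_trans hlty; apply: le_esum => z _; rewrite lee_fin ge_max normr_ge0.
  by rewrite ler_norm.
have qlty : (\esum_(z in [set: lattice d]) (q z)%:E < +oo)%E.
  apply: le_lt_trans hlty; apply: le_esum => z _; rewrite lee_fin ge_max normr_ge0.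
  by rewrite -normrN ler_norm.
have -> : lattice_sum h = fine (\esum_(z in [set: lattice d]) (p z)%:E) -
    fine (\esum_(z in [set: lattice d]) (q z)%:E).
  rewrite /lattice_sum -fineB.
  - congr (fine (_ - _)); apply: eq_esum => z _.
      by rewrite /p funeposE /= EFin_max.
    by rewrite /q funenegE /= EFin_max EFinN.
  - by rewrite ge0_fin_numE // esum_ge0 // => z _; rewrite lee_fin.
  - by rewrite ge0_fin_numE // esum_ge0 // => z _; rewrite lee_fin.
rewrite (_ : (fun n => _) = (fun n => \sum_(z <- box d n) p z - \sum_(z <- box d n) q z)).
  by apply: cvgB; exact: box_sum_cvg.
apply/funext => n; rewrite -sumrB; apply: eq_bigr => z _.
rewrite /p /q /Order.max; case: (ltP (h z) 0) => ?; case: (ltP (- h z) 0) => ?; lra.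
Qed.

(** The box of radius [2 n] has at most [(5 n) ^ d] points, of which all but
    boundedly many have small [|u|]. *)
Lemma box_average_small (u : lattice d -> R) (eps : R) : (0 < d)%N -> 0 < eps ->
  (forall eta, 0 < eta -> exists k, forall y, (k < sup_norm y)%N -> `|u y| <= eta) ->
  exists n1, forall n, (n1 <= n)%N -> (0 < n)%N ->
    \sum_(x <- box d (2 * n)) `|u x| <= eps * n%:R ^+ d.
Proof.
move=> d_gt0 eps0 u0.
pose eta := eps / 2 / 5 ^+ d.
have eta0 : 0 < eta by rewrite !divr_gt0 ?exprn_gt0.
have [k hk] := u0 eta eta0.
pose S := \sum_(x <- box d k) `|u x|.
have S0 : 0 <= S by apply: sumr_ge0.
exists (maxn k (Num.truncn (2 * S / eps)).+1) => n; rewrite geq_max => /andP[kn nS] n0.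
have n1 : 1 <= n%:R :> R by rewrite ler1n.
have kn2 : (k <= 2 * n)%N by apply: leq_trans kn _; rewrite leq_pmull.
have Sn : S <= eps / 2 * n%:R ^+ d.
  apply: (@le_trans _ _ (eps / 2 * n%:R)).
    have : 2 * S / eps <= n%:R.
      by apply: ltW; apply: lt_le_trans (truncnS_gt _) _; rewrite ler_nat.
    by rewrite ler_pdivrMr //; lra.
  rewrite ler_pM2l ?divr_gt0 // -[leLHS]expr1.
  by apply: ler_weXn2l.
apply: (@le_trans _ _ (S + eta * (5 * n%:R) ^+ d)); last first.
  rewrite exprMn mulrA /eta divfK ?gt_eqF ?exprn_gt0 //.
  by move: Sn; lra.
have -> : S = \sum_(x <- box d (2 * n)) (sup_norm x <= k)%N%:R * `|u x|.
  rewrite (@box_sum_supp _ _ _ kn2) => [|z]; last by rewrite ltnNge => /negbTE->; rewrite mul0r.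
  rewrite /S big_seq [RHS]big_seq; apply: eq_bigr => x.
  by rewrite mem_box => ->; rewrite mul1r.
apply: (@le_trans _ _ (\sum_(x <- box d (2 * n)) ((sup_norm x <= k)%N%:R * `|u x| + eta))).
  apply: ler_sum => x _; case: leqP => xk; first by rewrite mul1r lerDl ltW.
  by rewrite mul0r add0r hk.
rewrite big_split lerD2l /= big_const_seq count_predT iter_addr_0 -[_ *+ _]mulr_natr.
rewrite ler_pM2l // size_box natrX lerXn2r ?nnegrE ?mulr_ge0 //.
by rewrite -natrM ler_nat; lia.
Qed.

End LatticeSums.

(** * Supersolutions *)

Section WeightSums.
Variables (R : realType) (d : nat) (sigma : R).
Hypothesis d_gt0 : (0 < d)%N.
Hypothesis sigma01 : 0 < sigma < 1.
Implicit Types (x y z : lattice d) (f u w V : lattice d -> R).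
Local Notation b := (@frac_weight R d sigma).

Lemma frac_weight_ge0 x y : 0 <= b x y.
Proof. by rewrite frac_weightE //; exact: translation_weight_ge0. Qed.

Lemma frac_weight_sym x y : b x y = b y x.
Proof.
rewrite (frac_weightE sigma d_gt0 x y) (frac_weightE sigma d_gt0 y x).
by rewrite -(opprB x y) translation_weightN.
Qed.

Lemma sum_frac_weight_trunc : exists2 C : R, 0 < C &
  forall (n : nat) x (F : seq (lattice d)), (0 < n)%N -> uniq F ->
  \sum_(y <- F) b x y * trunc_dist R n (x - y) ^+ 2 <= C * n%:R `^ (- (2 * sigma)).
Proof.
have [C C0 hC] := sum_translation_weight_trunc d_gt0 sigma01.
exists C => // n x F n0 uF.
have uF' : uniq [seq x - y | y <- F].
  by rewrite map_inj_uniq // => y z /addrI/oppr_inj.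
apply: le_trans (hC n _ n0 uF'); rewrite big_map.
by apply: ler_sum => y _; rewrite frac_weightE.
Qed.

Lemma sum_frac_weight_le : exists2 C : R, 0 < C &
  forall x (F : seq (lattice d)), uniq F -> \sum_(y <- F) b x y <= C.
Proof.
have [C C0 hC] := sum_frac_weight_trunc; exists C => // x F uF.
have := hC 1%N x F isT uF; rewrite powR1 mulr1; apply: le_trans.
apply: ler_sum => y _; rewrite frac_weightE //.
have [->|xy] := eqVneq (x - y) 0; first by rewrite translation_weight0 mul0r.
by rewrite trunc_dist1 // expr1n mulr1.
Qed.

Definition total_weight x : R := fine (\esum_(y in [set: lattice d]) (b x y)%:E).

Lemma total_weight_cvg x : (fun n => \sum_(y <- box d n) b x y) @ \oo --> total_weight x.
Proof.
apply: box_sum_cvg; first by move=> y; exact: frac_weight_ge0.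
have [C _ hC] := sum_frac_weight_le.
apply: (@esum_lty _ _ _ C); first by move=> y; exact: frac_weight_ge0.
by move=> n; apply: hC; exact: box_uniq.
Qed.

Lemma total_weight_le : exists2 C : R, 0 < C & forall x, total_weight x <= C.
Proof.
have [C C0 hC] := sum_frac_weight_le; exists C => // x.
apply: (ler_cvg_to (total_weight_cvg (x := x)) (cvg_cst C)).
by apply: nearW => n; apply: hC; exact: box_uniq.
Qed.

Lemma frac_laplacian_cvg f x : frac_domain sigma f ->
  (fun n => \sum_(y <- box d n) b x y * (f x - f y)) @ \oo --> frac_laplacian sigma f x.
Proof.
move=> fdom; apply: lattice_sum_cvg.
have [C _ hC] := sum_frac_weight_le.
have bf0 y : 0 <= b x y * `|f y| by rewrite mulr_ge0 ?frac_weight_ge0.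
apply: (@esum_lty _ _ _ (C * `|f x| +
   fine (\esum_(y in [set: lattice d]) (b x y * `|f y|)%:E))) => // n.
apply: (@le_trans _ _ (\sum_(y <- box d n) (b x y * `|f x| + b x y * `|f y|))).
  apply: ler_sum => y _; rewrite normrM (ger0_norm (frac_weight_ge0 _ _)) -mulrDr.
  by rewrite ler_wpM2l ?frac_weight_ge0 // ler_normB.
rewrite big_split -mulr_suml /=; apply: lerD.
  by rewrite ler_wpM2r // hC // box_uniq.
rewrite -lee_fin fineK; first exact: box_sum_le_esum.
by rewrite ge0_fin_numE ?fdom // esum_ge0 // => y _; rewrite lee_fin.
Qed.

Lemma schrodinger_cvg V f x : frac_domain sigma f ->
  (fun n => \sum_(y <- box d n) b x y * f y) @ \oo -->
  (total_weight x + V x) * f x - frac_schrodinger sigma V f x.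
Proof.
move=> fdom; rewrite /frac_schrodinger.
rewrite (_ : _ - _ = f x * total_weight x - frac_laplacian sigma f x); last by ring.
rewrite (_ : (fun n => _) = (fun n => f x * \sum_(y <- box d n) b x y -
   \sum_(y <- box d n) b x y * (f x - f y))).
  apply: cvgB; last exact: frac_laplacian_cvg.
  by apply: cvgMl_tmp; exact: total_weight_cvg.
apply/funext => n; rewrite mulr_sumr -sumrB; apply: eq_bigr => y _; ring.
Qed.

Lemma supersolution_le V w x n : frac_domain sigma w -> (forall y, 0 <= w y) ->
  0 <= frac_schrodinger sigma V w x ->
  \sum_(y <- box d n) b x y * w y <= (total_weight x + V x) * w x.
Proof.
move=> wdom w0 Hw.
have h : \sum_(y <- box d n) b x y * w y <=
    (total_weight x + V x) * w x - frac_schrodinger sigma V w x.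
  apply: (ler_cvg_to (cvg_cst _) (@schrodinger_cvg V w x wdom)).
  exists n => // m /= nm; apply: box_sum_le => // y.
  by rewrite mulr_ge0 ?frac_weight_ge0.
by apply: le_trans h _; rewrite gerDl oppr_le0.
Qed.

Lemma frac_weight_gt0 x y : x != y -> 0 < b x y.
Proof.
move=> xy; have [c c0 hc] := translation_weight_lower d_gt0 sigma01.
have := lt_le_trans c0 (hc (x - y) _); rewrite subr_eq0 xy => /(_ isT).
rewrite -frac_weightE // pmulr_lgt0 // powR_gt0 // ltr0n sup_norm_gt0.
by rewrite subr_eq0.
Qed.

(** At a zero of [w] the supersolution inequality makes the sum of the values of [w],
    taken with positive weights, nonpositive. *)
Lemma supersolution_gt0 V w : frac_domain sigma w -> (exists x, w x <> 0) ->
  (forall x, 0 <= w x) -> (forall x, 0 <= frac_schrodinger sigma V w x) ->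
  forall x, 0 < w x.
Proof.
move=> wdom [y wy] w0 Hw x; rewrite lt_neqAle w0 andbT eq_sym.
apply/eqP => wx0.
have xy : x != y by apply/eqP => xy; apply: wy; rewrite -xy.
have wy0 : 0 < w y by rewrite lt_neqAle w0 andbT eq_sym; apply/eqP.
have := supersolution_le (sup_norm y) wdom w0 (Hw x).
rewrite wx0 mulr0 leNgt => /negP; apply.
have yin : y \in box d (sup_norm y) by rewrite mem_box.
rewrite (bigD1_seq y) ?box_uniq //=.
apply: ltr_wpDr; last by rewrite mulr_gt0 ?frac_weight_gt0.
by apply: sumr_ge0 => z _; rewrite mulr_ge0 ?frac_weight_ge0.
Qed.

End WeightSums.

(** * The quadratic form and cutoffs *)

Section QuadraticForms.
Variables (R : realType) (I : eqType).
Implicit Types (X : seq I) (K : I -> I -> R) (p u w D : I -> R).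

Lemma sum_sym_form X K p : (forall x y, K x y = K y x) ->
  \sum_(x <- X) \sum_(y <- X) K x y * (p x ^+ 2 - p x * p y) =
  2^-1 * \sum_(x <- X) \sum_(y <- X) K x y * (p x - p y) ^+ 2.
Proof.
move=> Ksym.
have sw : \sum_(x <- X) \sum_(y <- X) K x y * (p x ^+ 2 - p x * p y) =
    \sum_(x <- X) \sum_(y <- X) K x y * (p y ^+ 2 - p x * p y).
  rewrite exchange_big /=; apply: eq_bigr => x _; apply: eq_bigr => y _.
  by rewrite Ksym [p y * _]mulrC.
have -> : \sum_(x <- X) \sum_(y <- X) K x y * (p x - p y) ^+ 2 =
    \sum_(x <- X) \sum_(y <- X) K x y * (p x ^+ 2 - p x * p y) +
    \sum_(x <- X) \sum_(y <- X) K x y * (p y ^+ 2 - p x * p y).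
  rewrite -big_split; apply: eq_bigr => x _; rewrite -big_split.
  by apply: eq_bigr => y _ /=; ring.
by rewrite -sw; field.
Qed.

(** Write [p = w psi]: by hypothesis [D x * w x] is at least the weighted sum of [w], so
    the diagonal term dominates the sum of [K x y w(x) w(y) psi(x)^2], and the
    symmetry of [K] completes the squares. *)
Lemma ground_state_form X K D w p : (forall x y, K x y = K y x) ->
  (forall x, 0 < w x) ->
  (forall x, \sum_(y <- X) K x y * w y <= D x * w x) ->
  2^-1 * \sum_(x <- X) \sum_(y <- X) K x y * w x * w y * (p x / w x - p y / w y) ^+ 2 <=
  \sum_(x <- X) D x * p x ^+ 2 - \sum_(x <- X) \sum_(y <- X) K x y * p x * p y.
Proof.
move=> Ksym w0 Dw.
rewrite -(@sum_sym_form X (fun x y => K x y * w x * w y) (fun x => p x / w x)); last first.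
  by move=> x y; rewrite Ksym; ring.
rewrite -sumrB; apply: ler_sum => x _.
have wx : w x != 0 by rewrite gt_eqF.
have -> : D x * p x ^+ 2 = D x * w x * (p x ^+ 2 / w x) by field.
have h : 0 <= p x ^+ 2 / w x by rewrite divr_ge0 ?sqr_ge0 // ltW.
apply: (@le_trans _ _ ((\sum_(y <- X) K x y * w y) * (p x ^+ 2 / w x) -
   \sum_(y <- X) K x y * p x * p y)); last by rewrite lerB // ler_wpM2r.
rewrite mulr_suml -sumrB le_eqVlt; apply/orP; left; apply/eqP.
by apply: eq_bigr => y _; field; rewrite !gt_eqF.
Qed.

(** The same computation for an arbitrary [u], where the failure of [u] to satisfy
    [D x * u x = sum K x y * u y] remains as an error term. *)
Lemma cutoff_form X K D u p : (forall x y, K x y = K y x) ->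
  \sum_(x <- X) D x * (u x * p x) ^+ 2 -
    \sum_(x <- X) \sum_(y <- X) K x y * (u x * p x) * (u y * p y) =
  \sum_(x <- X) p x ^+ 2 * u x * (D x * u x - \sum_(y <- X) K x y * u y) +
  2^-1 * \sum_(x <- X) \sum_(y <- X) K x y * u x * u y * (p x - p y) ^+ 2.
Proof.
move=> Ksym.
rewrite -(@sum_sym_form X (fun x y => K x y * u x * u y) p); last first.
  by move=> x y; rewrite Ksym; ring.
rewrite -sumrB -big_split; apply: eq_bigr => x _ /=.
rewrite mulrBr mulr_sumr -addrA; congr (_ + _); first by ring.
by rewrite -sumrN -sumrN -big_split; apply: eq_bigr => y _ /=; ring.
Qed.

End QuadraticForms.

Section Cutoff.
Variables (R : realType) (d : nat) (sigma : R).
Hypothesis d_gt0 : (0 < d)%N.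
Hypothesis sigma01 : 0 < sigma < 1.
Implicit Types (x y z : lattice d) (f u w V : lattice d -> R).
Local Notation b := (@frac_weight R d sigma).

Definition cutoff (n : nat) x : R := Num.max 0 (Num.min 1 (2 - (sup_norm x)%:R / n%:R)).

Lemma cutoff_eq1 n x : (0 < n)%N -> (sup_norm x <= n)%N -> cutoff n x = 1.
Proof.
move=> n0 xn; have : (sup_norm x)%:R / n%:R <= 1 :> R.
  by rewrite ler_pdivrMr ?ltr0n // mul1r ler_nat.
rewrite /cutoff /Order.max /Order.min => h.
by case: (ltP 1 (2 - (sup_norm x)%:R / n%:R)) => ?; case: ltP => ?; lra.
Qed.

Lemma cutoff_eq0 n x : (0 < n)%N -> (2 * n <= sup_norm x)%N -> cutoff n x = 0.
Proof.
move=> n0 xn; have : 2 <= (sup_norm x)%:R / n%:R :> R.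
  by rewrite ler_pdivlMr ?ltr0n // -natrM ler_nat.
rewrite /cutoff /Order.max /Order.min => h.
by case: (ltP 1 (2 - (sup_norm x)%:R / n%:R)) => ?; case: ltP => ?; lra.
Qed.

Lemma cutoffB_sq_le n x y : (0 < n)%N ->
  (cutoff n x - cutoff n y) ^+ 2 <= trunc_dist R n (x - y) ^+ 2.
Proof.
move=> n0; rewrite -[leLHS]real_normK ?num_real //.
have n0' : 0 < n%:R :> R by rewrite ltr0n.
have t0 : 0 <= trunc_dist R n (x - y) by case/andP: (trunc_dist_itv R n (x - y)).
rewrite lerXn2r ?nnegrE //.
have h1 : (sup_norm x)%:R / n%:R - (sup_norm y)%:R / n%:R <= (sup_norm (x - y))%:R / n%:R :> R.
  by rewrite -mulrBl ler_wpM2r ?invr_ge0 ?(ltW n0') // lerBlDr -natrD ler_nat sup_normB.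
have h2 : (sup_norm y)%:R / n%:R - (sup_norm x)%:R / n%:R <= (sup_norm (x - y))%:R / n%:R :> R.
  rewrite -[x - y]opprB sup_normN.
  by rewrite -mulrBl ler_wpM2r ?invr_ge0 ?(ltW n0') // lerBlDr -natrD ler_nat sup_normB.
move: h1 h2; rewrite /cutoff /trunc_dist ler_norml.
set A := _ / _; set B := (sup_norm y)%:R / _; set C := (sup_norm (x - y))%:R / _ => h1 h2.
rewrite /Order.max /Order.min.
case: (ltP 1 (2 - A)) => ?; case: (ltP 1 (2 - B)) => ?; case: (ltP 1 C) => ?;
  case: ltP => ?; case: ltP => ?; lra.
Qed.

(** A pair of points on which the cutoff differs has its inner point in the box of
    radius [2 n] and its outer point outside the box of radius [n].  Bounding [u] at
    the outer point by [alpha] leaves the truncated moment of the weight at the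
    inner point. *)
Lemma cutoff_energy_le (C alpha : R) (n M : nat) u :
  (forall (n : nat) x (F : seq (lattice d)), (0 < n)%N -> uniq F ->
     \sum_(y <- F) b x y * trunc_dist R n (x - y) ^+ 2 <= C * n%:R `^ (- (2 * sigma))) ->
  (0 < n)%N -> (2 * n <= M)%N -> 0 <= alpha ->
  (forall y, (n < sup_norm y)%N -> `|u y| <= alpha) ->
  2^-1 * \sum_(x <- box d M) \sum_(y <- box d M)
     b x y * u x * u y * (cutoff n x - cutoff n y) ^+ 2 <=
  (\sum_(x <- box d (2 * n)) `|u x|) * (alpha * (C * n%:R `^ (- (2 * sigma)))).
Proof.
move=> hC n0 nM alpha0 hu.
have b0 x y : 0 <= b x y by exact: frac_weight_ge0.
pose s x : R := (sup_norm x <= 2 * n)%N%:R.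
pose r x y := s x * `|u x| * (alpha * (b x y * trunc_dist R n (x - y) ^+ 2)).
have s0 x : 0 <= s x by rewrite /s; case: leq.
have bs0 x y (c : R) : 0 <= b x y * c ^+ 2 by apply: mulr_ge0 => //; exact: sqr_ge0.
have r0 x y : 0 <= r x y.
  by apply: mulr_ge0; [exact: mulr_ge0|apply: mulr_ge0 => //; exact: bs0].
have term x y : (sup_norm x <= sup_norm y)%N ->
    b x y * u x * u y * (cutoff n x - cutoff n y) ^+ 2 <= r x y.
  move=> xy; have [yn|yn] := leqP (sup_norm y) n.
    rewrite (cutoff_eq1 n0 yn) (cutoff_eq1 n0 (leq_trans xy yn)) subrr expr0n mulr0.
    exact: r0.
  have [xn|xn] := leqP (sup_norm x) (2 * n)%N; last first.
    rewrite (cutoff_eq0 n0 (ltnW xn)) (cutoff_eq0 n0 (leq_trans (ltnW xn) xy)).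
    by rewrite subrr expr0n mulr0 r0.
  rewrite /r /s xn mul1r -mulrA.
  rewrite (_ : b x y * u x * _ = (u x * u y) * (b x y * (cutoff n x - cutoff n y) ^+ 2)); last by ring.
  apply: (@le_trans _ _ (`|u x| * `|u y| * (b x y * (cutoff n x - cutoff n y) ^+ 2))).
    by rewrite ler_wpM2r ?bs0 // -normrM ler_norm.
  rewrite -mulrA ler_wpM2l //; apply: ler_pM; rewrite ?bs0 ?hu //.
  by rewrite ler_wpM2l // cutoffB_sq_le.
have term2 x y : b x y * u x * u y * (cutoff n x - cutoff n y) ^+ 2 <= r x y + r y x.
  have [xy|yx] := leqP (sup_norm x) (sup_norm y).
    by apply: le_trans (term _ _ xy) _; rewrite lerDl.
  have := term _ _ (ltnW yx); rewrite frac_weight_sym // => h.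
  apply: (@le_trans _ _ (r y x)); last by rewrite lerDr.
  by apply: le_trans h; rewrite le_eqVlt; apply/orP; left; apply/eqP; ring.
have sum_r : \sum_(x <- box d M) \sum_(y <- box d M) r x y <=
    (\sum_(x <- box d (2 * n)) `|u x|) * (alpha * (C * n%:R `^ (- (2 * sigma)))).
  have -> : \sum_(x <- box d (2 * n)) `|u x| = \sum_(x <- box d M) s x * `|u x|.
    rewrite (@box_sum_supp _ _ _ _ _ nM) => [|z]; last by rewrite ltnNge /s => /negbTE->; rewrite mul0r.
    rewrite big_seq [RHS]big_seq; apply: eq_bigr => x.
    by rewrite mem_box /s => ->; rewrite mul1r.
  rewrite mulr_suml; apply: ler_sum => x _.
  rewrite /r -mulr_sumr ler_wpM2l ?mulr_ge0 // -mulr_sumr ler_wpM2l //.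
  by apply: hC => //; exact: box_uniq.
apply: (@le_trans _ _ (2^-1 * \sum_(x <- box d M) \sum_(y <- box d M) (r x y + r y x))).
  by rewrite ler_pM2l ?invr_gt0 //; apply: ler_sum => x _; apply: ler_sum => y _; exact: term2.
apply: le_trans sum_r; rewrite le_eqVlt; apply/orP; left; apply/eqP.
under eq_bigr do rewrite big_split.
rewrite big_split /= [X in _ + X]exchange_big /=.
by field.
Qed.

End Cutoff.

(** * The energy of a cut-off solution *)

Section Proportionality.
Variables (R : realType) (d : nat) (sigma : R).
Hypothesis d_gt0 : (0 < d)%N.
Hypothesis sigma01 : 0 < sigma < 1.
Implicit Types (x y z : lattice d) (f u w V : lattice d -> R).
Local Notation b := (@frac_weight R d sigma).

Lemma sum_cvg0 (I : Type) (r : seq I) (c : I -> R) (g : I -> R^nat) :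
  (forall i, g i @ \oo --> (0 : R)) ->
  (fun n => \sum_(i <- r) c i * g i n) @ \oo --> (0 : R).
Proof.
move=> g0; elim: r => [|i r IH].
  by apply: cvg_near_cst; apply: nearW => n; rewrite big_nil.
rewrite (_ : (fun n => _) = (fun n => c i * g i n + \sum_(j <- r) c j * g j n)).
  rewrite -[X in _ --> X](addr0 0) -[X in X + _](mulr0 (c i)).
  by apply: cvgD; [apply: cvgMl_tmp; exact: g0|exact: IH].
by apply/funext => n; rewrite big_cons.
Qed.

(** In a box of radius [M] the ground state form of [w] is at most the cutoff form
    of [u].  The error term of the latter sums over a fixed box, where it tends to
    0 as [M] tends to infinity because [u] is harmonic; the energy term is bounded
    uniformly in [M]. *)
Lemma ratio_difference_le (C alpha : R) (n : nat) V u w x0 y0 :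
  (forall (n : nat) x (F : seq (lattice d)), (0 < n)%N -> uniq F ->
     \sum_(y <- F) b x y * trunc_dist R n (x - y) ^+ 2 <= C * n%:R `^ (- (2 * sigma))) ->
  is_harmonic sigma V u ->
  frac_domain sigma w -> (forall x, 0 < w x) ->
  (forall x, 0 <= frac_schrodinger sigma V w x) ->
  (0 < n)%N -> 0 <= alpha -> (forall y, (n < sup_norm y)%N -> `|u y| <= alpha) ->
  (sup_norm x0 <= n)%N -> (sup_norm y0 <= n)%N ->
  2^-1 * (b x0 y0 * w x0 * w y0 * (u x0 / w x0 - u y0 / w y0) ^+ 2) <=
  (\sum_(x <- box d (2 * n)) `|u x|) * (alpha * (C * n%:R `^ (- (2 * sigma)))).
Proof.
move=> hC [udom uharm] wdom w0 Hw n0 alpha0 hu x0n y0n.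
set E := _ * (alpha * _).
pose D x := total_weight sigma x + V x.
pose e := @cutoff R d n.
pose T M := \sum_(x <- box d (2 * n)) e x ^+ 2 * u x *
   (D x * u x - \sum_(y <- box d M) b x y * u y).
(* [T M] is the error term of the cutoff form. *)
have T_cvg : (fun M => T M + E) @ \oo --> E.
  rewrite -[X in _ --> X]add0r; apply: cvgD; last exact: cvg_cst.
  apply: sum_cvg0 => x; rewrite -[X in _ --> X](subrr (D x * u x)); apply: cvgB; first exact: cvg_cst.
  have := @schrodinger_cvg R d sigma d_gt0 sigma01 V u x udom.
  by rewrite uharm subr0.
apply: (ler_cvg_to (cvg_cst _) T_cvg); exists (2 * n)%N => // M /= nM.
have n2 : (n <= 2 * n)%N by rewrite leq_pmull.
have bsym x y : b x y = b y x by exact: frac_weight_sym.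
have b0 x y : 0 <= b x y by exact: frac_weight_ge0.
have term0 x y (c : R) : 0 <= b x y * w x * w y * c ^+ 2.
  by rewrite mulr_ge0 ?sqr_ge0 // mulr_ge0 ?(ltW (w0 _)) // mulr_ge0 // ltW.
have super x : \sum_(y <- box d M) b x y * w y <= D x * w x.
  by apply: supersolution_le => // y; exact: ltW.
have low := @ground_state_form R _ (box d M) b D w (fun x => u x * e x) bsym w0 super.
have := le_trans _ low; rewrite (@cutoff_form R _ (box d M) b D u e bsym) => h.
apply: (le_trans (h _ _)).
  rewrite ler_pM2l ?invr_gt0 //.
  have x0M : x0 \in box d M by rewrite mem_box (leq_trans x0n) // (leq_trans n2).
  have y0M : y0 \in box d M by rewrite mem_box (leq_trans y0n) // (leq_trans n2).
  rewrite (bigD1_seq x0) ?box_uniq //= (bigD1_seq y0) ?box_uniq //=.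
  rewrite /e !cutoff_eq1 // !mulr1 -addrA lerDl addr_ge0 //.
    by apply: sumr_ge0 => y _; exact: term0.
  by apply: sumr_ge0 => x _; apply: sumr_ge0 => y _; exact: term0.
apply: lerD; last exact: cutoff_energy_le.
rewrite /T (@box_sum_supp _ _ _ _ _ nM) // => z zn.
by rewrite /e cutoff_eq0 ?(ltnW zn) // expr0n mul0r mul0r.
Qed.

Lemma sup_norm_le_enorm z : (sup_norm z)%:R <= enorm R z.
Proof.
rewrite -[leLHS]ger0_norm // -sqrtr_sqr; apply: ler_wsqrtr.
exact: norm_sq_ge_sup.
Qed.

Lemma bigO_sup_norm u (p : R) : p < 0 ->
  is_bigO u (fun x => enorm R x `^ p) ->
  exists2 A : R, 0 < A & exists n0, forall y, (n0 < sup_norm y)%N ->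
    `|u y| <= A * (sup_norm y)%:R `^ p.
Proof.
move=> p0 /ereal_inf_lt[_ [A cA <-]] Alty.
have [n0 hn0] := finite_set_box cA.
have [c cA'] : exists c : R, forall x, A x -> `|u x| / `|enorm R x `^ p| <= c.
  have le_sup x : A x -> ((`|u x| / `|enorm R x `^ p|)%:E <= ereal_sup
      [set (`|u x| / `|enorm R x `^ p|)%:E | x in A])%E.
    by move=> Ax; apply: ereal_sup_ubound; exists x.
  case: (ereal_sup _) Alty le_sup => [c _ h| // |_ h].
    by exists c => x /h; rewrite lee_fin.
  by exists 0 => x /h.
exists (`|c| + 1); first by rewrite ltr_wpDl.
exists n0 => y yn.
have Ay : A y by apply: contrapT => /hn0; rewrite leqNgt yn.
have y0 : (0 < sup_norm y)%N by apply: leq_ltn_trans yn.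
have sy0 : 0 < (sup_norm y)%:R :> R by rewrite ltr0n.
have ey := lt_le_trans sy0 (sup_norm_le_enorm y).
have ep : 0 < enorm R y `^ p by rewrite powR_gt0.
have := cA' _ Ay; rewrite (gtr0_norm ep) ler_pdivrMr // => h.
apply: le_trans h _; apply: (@le_trans _ _ ((`|c| + 1) * enorm R y `^ p)).
  by rewrite ler_pM2r // (le_trans (ler_norm c)) // lerDl.
apply: ler_wpM2l; first by rewrite addr_ge0.
have [q q0 ->] : exists2 q, 0 <= q & p = - q.
  by exists (- p); rewrite ?opprK // oppr_ge0 ltW.
rewrite !powRN lef_pV2 ?posrE ?powR_gt0 //.
by apply: ge0_ler_powR; rewrite ?nnegrE ?(ltW sy0) ?(ltW ey) ?sup_norm_le_enorm.
Qed.

End Proportionality.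

(** * Comparison with a positive supersolution *)

Section Conclusion.
Variables (R : realType) (d : nat) (sigma : R).
Hypothesis d_gt0 : (0 < d)%N.
Hypothesis sigma01 : 0 < sigma < 1.
Hypothesis sigma_d : 2 * sigma < d%:R.
Implicit Types (x y z : lattice d) (f u w V : lattice d -> R).
Local Notation b := (@frac_weight R d sigma).

Lemma powR_neg_small (A p eta : R) : 0 < A -> p < 0 -> 0 < eta ->
  exists k, forall n : nat, (k < n)%N -> A * n%:R `^ p <= eta.
Proof.
move=> A0 p0 eta0.
have [q q0 ->] : exists2 q, 0 < q & p = - q.
  by exists (- p); rewrite ?opprK // oppr_gt0.
exists (Num.truncn ((A / eta) `^ q^-1)) => n kn.
have Aeta : 0 < A / eta by rewrite divr_gt0.
have n0 : 0 < n%:R :> R by rewrite ltr0n (leq_ltn_trans _ kn).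
rewrite powRN ler_pdivrMr ?powR_gt0 // mulrC -ler_pdivrMr //.
have -> : A / eta = ((A / eta) `^ q^-1) `^ q.
  by rewrite -powRrM mulVf ?gt_eqF // powRr1 // ltW.
apply: ge0_ler_powR; rewrite ?nnegrE ?powR_ge0 ?(ltW q0) ?(ltW n0) //.
by apply: ltW; apply: lt_le_trans (truncnS_gt _) _; rewrite ler_nat.
Qed.

(** In the bound of [ratio_difference_le] the powers of [n] combine to
    [n ^ (2 sigma - d) n ^ (- 2 sigma) = n ^ (- d)], and the sum of [|u|] over
    the box is [o(n ^ d)]. *)
Lemma ratio_constant V u w x y :
  is_harmonic sigma V u ->
  frac_domain sigma w -> (forall z, 0 < w z) ->
  (forall z, 0 <= frac_schrodinger sigma V w z) ->
  is_bigO u (fun z => enorm R z `^ (2 * sigma - d%:R)) ->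
  u x / w x = u y / w y.
Proof.
move=> uharm wdom w0 Hw uO.
have [->//|xy] := eqVneq x y.
have p0 : 2 * sigma - d%:R < 0 by rewrite subr_lt0.
have [A A0 [n0 hA]] := bigO_sup_norm d_gt0 p0 uO.
have [C C0 hC] := sum_frac_weight_trunc d_gt0 sigma01.
have AC0 : 0 < A * C by rewrite mulr_gt0.
apply/eqP; rewrite -subr_eq0; apply/negPn/negP => diff.
set v := 2^-1 * (b x y * w x * w y * (u x / w x - u y / w y) ^+ 2).
have v0 : 0 < v.
  have bww : 0 < b x y * w x * w y.
    by apply: mulr_gt0 => //; apply: mulr_gt0 => //; exact: frac_weight_gt0.
  have sq : 0 < (u x / w x - u y / w y) ^+ 2 by rewrite lt_neqAle eq_sym sqrf_eq0 diff sqr_ge0.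
  by apply: mulr_gt0; [rewrite invr_gt0|exact: mulr_gt0].
have u_small eta : 0 < eta -> exists k, forall z, (k < sup_norm z)%N -> `|u z| <= eta.
  move=> eta0; have [k hk] := powR_neg_small A0 p0 eta0.
  exists (maxn k n0) => z; rewrite gtn_max => /andP[kz n0z].
  by apply: le_trans (hA _ n0z) (hk _ kz).
(* With this choice the bound below equals [v / 2]. *)
have eps0 : 0 < v / 2 / (A * C) by rewrite !divr_gt0.
have [n1 hn1] := box_average_small d_gt0 eps0 u_small.
have [n [npos n0n n1n xn yn]] : exists n,
    [/\ 0 < n, n0 <= n, n1 <= n, sup_norm x <= n & sup_norm y <= n]%N.
  exists (maxn (maxn n0 n1) (maxn (sup_norm x) (sup_norm y))).+1.
  by split=> //; apply: leqW; rewrite !leq_max leqnn ?orbT.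
have n_gt0 : 0 < n%:R :> R by rewrite ltr0n.
pose alpha : R := A * n%:R `^ (2 * sigma - d%:R).
have alpha0 : 0 <= alpha by rewrite mulr_ge0 ?powR_ge0 // ltW.
have halpha z : (n < sup_norm z)%N -> `|u z| <= alpha.
  move=> nz; have n0z : (n0 < sup_norm z)%N by exact: leq_ltn_trans nz.
  apply: le_trans (hA _ n0z) _; rewrite ler_pM2l //.
  have [q q0 ->] : exists2 q, 0 <= q & 2 * sigma - d%:R = - q.
    by exists (d%:R - 2 * sigma); [rewrite subr_ge0 ltW|rewrite opprB].
  have z0 : 0 < (sup_norm z)%:R :> R by rewrite ltr0n (leq_trans _ n0z).
  rewrite !powRN lef_pV2 ?posrE ?powR_gt0 //.
  by apply: ge0_ler_powR; rewrite ?nnegrE ?(ltW n_gt0) ?(ltW z0) // ler_nat ltnW.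
have := ratio_difference_le d_gt0 sigma01 hC uharm wdom w0 Hw npos alpha0 halpha xn yn.
rewrite -/v leNgt => /negP; apply.
have hS : \sum_(z <- box d (2 * n)) `|u z| <= v / 2 / (A * C) * n%:R ^+ d.
  exact: hn1.
have X0 : 0 <= alpha * (C * n%:R `^ (- (2 * sigma))).
  by rewrite mulr_ge0 // mulr_ge0 ?powR_ge0 // ltW.
apply: le_lt_trans (ler_wpM2r X0 hS) _.
have nn : n%:R `^ (2 * sigma - d%:R) * n%:R `^ (- (2 * sigma)) * n%:R ^+ d = 1 :> R.
  rewrite -powRD_gt0 // -powR_mulrn ?(ltW n_gt0) // -powRD_gt0 //.
  by rewrite (_ : _ + _ = 0) ?powRr0 //; ring.
rewrite [ltLHS](_ : _ = v / 2 / (A * C) * (A * C) *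
   (n%:R `^ (2 * sigma - d%:R) * n%:R `^ (- (2 * sigma)) * n%:R ^+ d)); last by rewrite /alpha; ring.
rewrite nn divfK ?gt_eqF // mulr1.
by rewrite ltr_pdivrMr // ltr_pMr // ltr1n.
Qed.

(** The supersolution inequality at [z], with only the term at 0 kept, bounds
    [w 0] times the weight by [w z] times the total weight plus 1. *)
Lemma positive_solution_lower V w : frac_domain sigma w -> (forall z, 0 < w z) ->
  (forall z, 0 <= frac_schrodinger sigma V w z) -> (forall z, V z <= 1) ->
  exists2 c : R, 0 < c &
    forall z, z != 0 -> c <= w z * enorm R z `^ (2 * sigma + d%:R).
Proof.
move=> wdom w0 Hw V1.
have [B B0 hB] := total_weight_le d_gt0 sigma01.
have [k k0 hk] := translation_weight_lower d_gt0 sigma01.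
have B1 : 0 < B + 1 by rewrite addr_gt0.
exists (w 0 * k / (B + 1)); first by rewrite divr_gt0 // mulr_gt0.
move=> z z0; rewrite ler_pdivrMr //.
have low : w 0 * b z 0 <= w z * (B + 1).
  apply: (@le_trans _ _ ((total_weight sigma z + V z) * w z)); last first.
    by rewrite mulrC ler_pM2l // lerD.
  apply: le_trans (supersolution_le d_gt0 sigma01 0 wdom (fun y => ltW (w0 y)) (Hw z)).
  have z_in : (0 : lattice d) \in box d 0 by rewrite mem_box leqn0 sup_norm_eq0.
  rewrite (bigD1_seq 0) ?box_uniq //= mulrC lerDl sumr_ge0 // => y _.
  by rewrite mulr_ge0 ?frac_weight_ge0 // ltW.
have e0 : (sup_norm z)%:R `^ (2 * sigma + d%:R) <= enorm R z `^ (2 * sigma + d%:R).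
  apply: ge0_ler_powR; rewrite ?nnegrE ?sqrtr_ge0 ?sup_norm_le_enorm //.
  by case/andP: sigma01 => s0 _; rewrite addr_ge0 // mulr_ge0 // ltW.
apply: (@le_trans _ _ (w 0 * (b z 0 * enorm R z `^ (2 * sigma + d%:R)))).
  rewrite ler_pM2l //; apply: le_trans (hk z z0) _.
  by rewrite frac_weightE // subr0 ler_wpM2l // translation_weight_ge0.
by rewrite mulrA [leRHS]mulrAC ler_wpM2r ?powR_ge0.
Qed.

End Conclusion.

Theorem theorem5p1 (R : realType) (d : nat) (sigma : R)
    (V u : lattice d -> R) :
  (1 <= d)%N ->
  0 < sigma < 1 ->
  0 < 2 * sigma < d%:R ->
  positive_schrodinger sigma V ->
  (forall x : lattice d, V x <= 1) ->
  is_harmonic sigma V u ->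
  is_bigO u (fun x : lattice d => enorm R x `^ (2 * sigma - d%:R)) ->
  liminf_infinity
    (fun x : lattice d => (`|u x| * enorm R x `^ (2 * sigma + d%:R))%:E) = 0%E ->
  forall x : lattice d, u x = 0.
Proof.
move=> d_gt0 sigma01 /andP[_ sigma_d] [w [wdom w_neq0 w_ge0 Hw]] V1 uharm uO ulim.
have w0 := supersolution_gt0 d_gt0 sigma01 wdom w_neq0 w_ge0 Hw.
pose c := u 0 / w 0.
have uc x : u x = c * w x.
  rewrite /c (ratio_constant d_gt0 sigma01 sigma_d 0 x uharm wdom w0 Hw uO).
  by rewrite divfK // gt_eqF.
have [c0 x|c0] := eqVneq c 0; first by rewrite uc c0 mul0r.
have [k k0 hk] := positive_solution_lower d_gt0 sigma01 wdom w0 Hw V1.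
have ck : 0 < `|c| * k by rewrite mulr_gt0 // normr_gt0.
suff : ((`|c| * k)%:E <= 0)%E by rewrite lee_fin leNgt ck.
rewrite -ulim /liminf_infinity.
apply: (@le_trans _ _ (ereal_inf ((fun x : lattice d =>
   (`|u x| * enorm R x `^ (2 * sigma + d%:R))%:E) @` [set x | x != 0]))); last first.
  apply: ereal_sup_ubound; exists [set x | x != 0] => //.
  rewrite /at_infinity /= (_ : ~` _ = [set 0]); first exact: finite_set1.
  by apply/seteqP; split => x /=; [move/negP/negPn/eqP|move=> ->; rewrite eqxx].
apply: le_ereal_inf_tmp => _ [x x0 <-]; rewrite lee_fin uc [in leRHS]normrM (gtr0_norm (w0 x)) -mulrA.
by rewrite ler_pM2l ?normr_gt0 // hk.
Qed.
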